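(* Let $N\ge1$ and consider the domain $\Omega=\{\mathbf w=(f_0,\alpha,f_2,\dots,f_N)^T\in\mathbb R^{N+1}:\ \alpha\in(-1,1),\ f_0\ne0\}$ and the coefficient matrix $\mathbf A(\mathbf w)=\tilde{\mathbf D}(\mathbf w)^{-1}\tilde{\mathbf M}(\mathbf w)\tilde{\mathbf D}(\mathbf w)$. Let $\lambda^{(N)}_0(\mathbf w)<\dots<\lambda^{(N)}_N(\mathbf w)$ be its eigenvalues (which depend only on $\alpha$ and are the zeros of $\tilde\phi_{N+1}$). Then the characteristic fields associated with $\lambda^{(N)}_0$ and $\lambda^{(N)}_N$ are genuinely nonlinear on $\Omega$: for $k\in\{0,N\}$, every $\mathbf w\in\Omega$, and every nonzero right eigenvector $\mathbf R$ of $\mathbf A(\mathbf w)$ for $\lambda^{(N)}_k(\mathbf w)$, one has $\nabla_{\mathbf w}\lambda^{(N)}_k(\mathbf w)\cdot\mathbf R\neq0$.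
   Context: For a parameter $\alpha\in(-1,1)$ define on $[-1,1]$ the weights $\omega(\mu)=(1+\alpha\mu)^{-4}$ and $\tilde\omega(\mu)=(1+\alpha\mu)^{-5}$. Let $\{\phi_k\}_{k\ge0}$ (resp. $\{\tilde\phi_k\}_{k\ge0}$) be the monic orthogonal polynomials on $[-1,1]$ with respect to $\omega$ (resp. $\tilde\omega$); their coefficients depend smoothly on $\alpha$. Set $K_{j,k}=\int_{-1}^1\mu^j\phi_k\,\omega\,d\mu$, $\tilde K_{j,k}=\int_{-1}^1\mu^j\tilde\phi_k\,\tilde\omega\,d\mu$, $\beta_k=K_{k,k}/\tilde K_{k,k}$, $\gamma_k=\tilde K_{k,k}^{-1}\,\partial K_{k,k}/\partial\alpha$. Given $\mathbf w=(f_0,\alpha,f_2,\dots,f_N)^T$, set $f_1:=0$. The $(N+1)\times(N+1)$ matrix $\tilde{\mathbf D}=\tilde{\mathbf D}(\mathbf w)$ (rows/columns indexed $0,\dots,N$) has entries $\tilde D_{0,0}=\beta_0$, $\tilde D_{0,1}=\gamma_0f_0$, $\tilde D_{1,0}=\alpha$, $\tilde D_{1,1}=-4f_0$; for $2\le i\le N$: $\tilde D_{i,1}=\gamma_if_i-4f_{i-1}$, $\tilde D_{i,i}=\beta_i$, and $\tilde D_{i,i-1}=\alpha$ when $i\ge3$; all other entries are $0$. Let $\tilde{\boldsymbol\Lambda}=\mathrm{diag}(\tilde K_{0,0},\dots,\tilde K_{N,N})$ and $\tilde{\mathbf M}=\tilde{\boldsymbol\Lambda}^{-1}\mathbf G$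 where $G_{i,j}=\int_{-1}^1\mu\,\tilde\phi_i\tilde\phi_j\,\tilde\omega\,d\mu$, $0\le i,j\le N$. *)

(* Defs.v *)
From Stdlib Require Import Reals Lra Lia Arith List ClassicalEpsilon.
Open Scope R_scope.

(* Total integral over [-1,1]: the Riemann integral when f is Riemann
   integrable on [-1,1] (its value does not depend on the proof), otherwise
   an unspecified real.  All integrands used below are continuous on [-1,1]. *)
Definition Int (f : R -> R) : R :=
  epsilon (inhabits 0)
    (fun I => exists pr : Riemann_integrable f (-1) 1, RiemannInt pr = I).

(* weight (1 + alpha mu)^(-p); p = 4 gives omega, p = 5 gives omega~ *)
Definition weight (p : nat) (a mu : R) : R := / (1 + a * mu) ^ p.

Definition is_monic_orth (p : nat) (a : R) (k : nat) (q : R -> R) : Prop :=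
  (exists c : nat -> R, c k = 1 /\
     forall x, q x = sum_f_R0 (fun i => c i * x ^ i) k) /\
  (forall j, (j < k)%nat -> Int (fun mu => mu ^ j * q mu * weight p a mu) = 0).

Definition phi (p : nat) (a : R) (k : nat) : R -> R :=
  epsilon (inhabits (fun _ => 0)) (is_monic_orth p a k).

Definition Kint (p : nat) (a : R) (j k : nat) : R :=
  Int (fun mu => mu ^ j * phi p a k mu * weight p a mu).

Definition dK (a : R) (k : nat) : R :=
  epsilon (inhabits 0) (fun l => derivable_pt_lim (fun b => Kint 4 b k k) a l).

Definition beta (a : R) (k : nat) : R := Kint 4 a k k / Kint 5 a k k.
Definition gamma (a : R) (k : nat) : R := / Kint 5 a k k * dK a k.

(* vectors of R^{N+1} and (N+1)x(N+1) matrices are functions on indices 0..N *)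
Definition matmul (N : nat) (A B : nat -> nat -> R) : nat -> nat -> R :=
  fun i j => sum_f_R0 (fun l => A i l * B l j) N.
Definition matvec (N : nat) (A : nat -> nat -> R) (v : nat -> R) : nat -> R :=
  fun i => sum_f_R0 (fun l => A i l * v l) N.
Definition kron (i j : nat) : R := if Nat.eqb i j then 1 else 0.

Definition matinv (N : nat) (D : nat -> nat -> R) : nat -> nat -> R :=
  epsilon (inhabits (fun _ _ => 0))
    (fun B => forall i j, (i <= N)%nat -> (j <= N)%nat ->
       matmul N B D i j = kron i j /\ matmul N D B i j = kron i j).

(* w = (f_0, alpha, f_2, ..., f_N): alpha = w 1, f_i = w i for i <> 1, f_1 = 0 *)
Definition alpha_of (w : nat -> R) : R := w 1%nat.
Definition f_of (w : nat -> R) (i : nat) : R := if Nat.eqb i 1 then 0 else w i.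

Definition Dt (N : nat) (w : nat -> R) (i j : nat) : R :=
  let a := alpha_of w in
  let f := f_of w in
  if Nat.eqb i 0 then
    (if Nat.eqb j 0 then beta a 0 else if Nat.eqb j 1 then gamma a 0 * f 0%nat else 0)
  else if Nat.eqb i 1 then
    (if Nat.eqb j 0 then a else if Nat.eqb j 1 then -4 * f 0%nat else 0)
  else if Nat.leb i N then
    (if Nat.eqb j 1 then gamma a i * f i - 4 * f (i - 1)%nat
     else if Nat.eqb j i then beta a i
     else if andb (Nat.leb 3 i) (Nat.eqb j (i - 1)) then a
     else 0)
  else 0.

Definition Gmat (a : R) (i j : nat) : R :=
  Int (fun mu => mu * phi 5 a i mu * phi 5 a j mu * weight 5 a mu).
Definition Lambda_t (a : R) (i j : nat) : R :=
  if Nat.eqb i j then Kint 5 a i i else 0.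
Definition Mt (N : nat) (w : nat -> R) : nat -> nat -> R :=
  matmul N (matinv N (Lambda_t (alpha_of w))) (Gmat (alpha_of w)).

Definition Amat (N : nat) (w : nat -> R) : nat -> nat -> R :=
  matmul N (matinv N (Dt N w)) (matmul N (Mt N w) (Dt N w)).

Definition is_eig (N : nat) (A : nat -> nat -> R) (l : R) : Prop :=
  exists v : nat -> R, (exists i, (i <= N)%nat /\ v i <> 0) /\
    forall i, (i <= N)%nat -> matvec N A v i = l * v i.

Definition kth_eig (N : nat) (A : nat -> nat -> R) (k : nat) (l : R) : Prop :=
  is_eig N A l /\
  exists s : list R, NoDup s /\ length s = k /\
    forall m, In m s <-> (is_eig N A m /\ m < l).

Definition lam (N k : nat) (w : nat -> R) : R :=
  epsilon (inhabits 0) (kth_eig N (Amat N w) k).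

Definition vupd (w : nat -> R) (j : nat) (t : R) : nat -> R :=
  fun i => if Nat.eqb i j then t else w i.

(* Main.v *)
From Stdlib Require Import Reals Lra Lia List FinFun ClassicalEpsilon.
From Coquelicot Require Import Coquelicot.
Require Import Defs.
Open Scope R_scope.

(** Write [P] for the monic orthogonal polynomial of degree [N + 1] for the
    weight [(1 + a x)^-5], [L5] for integration against that weight, and [L6] for
    integration against [(1 + a x)^-6].  Identifying a vector [u] with
    [sum_j u_j phi_j], an eigenvector of [Mt] for [l] is a polynomial [e] of degree
    [<= N] with [(x - l) e] proportional to [P]; hence the eigenvalues are the
    zeros of [P], they depend on [alpha] only, and the coefficient [u_j] is
    proportional to [phi_j(l) / K_jj].  The gradient of [lambda_k] therefore has
    only an [alpha]-component, and two facts are needed.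

    The derivative of the zero is nonzero (Markov): with [q = P / (x - l)] frozen,
    differentiating [L5 (P q) = 0] in [alpha] gives
    [dP(l) L5(q) = 5 L6(x P q)], and [(1 + a l) L6(x P q) = L6(P^2) > 0].

    The [alpha]-component of the eigenvector is nonzero: since
    [4 beta_0 + alpha gamma_0 = 4], the first two rows of [Dt] show that it vanishes
    only if [L5((x - l)(1 + a x)) = 0].  By Gauss quadrature at the [N + 1 >= 2]
    zeros of [P] this is impossible when [l] is the smallest or the largest one. *)

(** [phi] and [lam] are chosen by [epsilon] separately at each point, so neither carries any
    regularity in the parameter. Regularity comes from a second description of the same objects: the
    three-term recurrence builds orthogonal polynomials with differentiable coefficients, and
    uniqueness identifies them with [phi]. A sign [s] with [s * s = 1] treats the smallest and the
    largest zero at once.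

    The integral [L5((x - l)(1 + a x))] is the integral of [x - l] against the weight of exponent 4,
    so the case to exclude says that [l] is the mean of that weight. An inner zero can be this mean
    (for [alpha = 0] and [N] even both are 0), which is why only the two outer fields are
    treated. *)

(** * Polynomial functions *)

(* Polynomial functions of degree [< n]; for [n = 0] only the zero function. *)
Fixpoint Pd (n : nat) (f : R -> R) : Prop :=
  match n with
  | O => forall x, f x = 0
  | S n => exists (c : R) (g : R -> R), Pd n g /\ forall x, f x = c * x ^ n + g x
  end.

Lemma Pd_ext n (f g : R -> R) : (forall x, f x = g x) -> Pd n f -> Pd n g.
Proof.
  destruct n as [|n]; simpl.
  - intros H Hf x. now rewrite <- H.
  - intros H (c & h & Hh & E). exists c, h. split; [exact Hh|].
    intros x. now rewrite <- H.
Qed.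

Lemma Pd_zero n : Pd n (fun _ => 0).
Proof.
  induction n as [|n IH]; simpl; [easy|].
  exists 0, (fun _ => 0). split; [exact IH|]. intros; ring.
Qed.

Lemma Pd_S n f : Pd n f -> Pd (S n) f.
Proof. intros H. exists 0, f. split; [exact H|]. intros; ring. Qed.

Lemma Pd_le n m f : (n <= m)%nat -> Pd n f -> Pd m f.
Proof. induction 1; intros; [assumption|]. now apply Pd_S, IHle. Qed.

Lemma Pd_pow k : Pd (S k) (fun x => x ^ k).
Proof. exists 1, (fun _ => 0). split; [apply Pd_zero|]. intros; ring. Qed.

Lemma Pd_const c : Pd 1 (fun _ => c).
Proof. exists c, (fun _ => 0). split; [apply Pd_zero|]. intros; simpl; ring. Qed.

Lemma Pd_plus n f g : Pd n f -> Pd n g -> Pd n (fun x => f x + g x).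
Proof.
  revert f g; induction n as [|n IH]; simpl; intros f g.
  - intros Hf Hg x. rewrite Hf, Hg. ring.
  - intros (c & h & Hh & E) (c' & h' & Hh' & E').
    exists (c + c'), (fun x => h x + h' x). split; [now apply IH|].
    intros x. rewrite E, E'. ring.
Qed.

Lemma Pd_scal n c f : Pd n f -> Pd n (fun x => c * f x).
Proof.
  revert f; induction n as [|n IH]; simpl; intros f.
  - intros Hf x. rewrite Hf. ring.
  - intros (d & h & Hh & E). exists (c * d), (fun x => c * h x).
    split; [now apply IH|]. intros x. rewrite E. ring.
Qed.

Lemma Pd_minus n f g : Pd n f -> Pd n g -> Pd n (fun x => f x - g x).
Proof.
  intros Hf Hg. apply Pd_ext with (fun x => f x + (-1) * g x); [intros; ring|].
  apply Pd_plus; [exact Hf|]. now apply Pd_scal.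
Qed.

Lemma Pd_mulx n f : Pd n f -> Pd (S n) (fun x => x * f x).
Proof.
  revert f; induction n as [|n IH]; intros f Hf.
  - apply Pd_ext with (fun _ => 0); [|apply Pd_zero].
    intros x. simpl in Hf. rewrite Hf. ring.
  - destruct Hf as (c & g & Hg & E).
    exists c, (fun x => x * g x). split; [now apply IH|].
    intros x. rewrite E. simpl. ring.
Qed.

Lemma Pd_mulpow n k f : Pd n f -> Pd (k + n) (fun x => x ^ k * f x).
Proof.
  intros Hf; induction k as [|k IH]; simpl plus.
  - apply Pd_ext with f; [intros; simpl; ring|exact Hf].
  - apply Pd_ext with (fun x => x * (x ^ k * f x)); [intros; simpl; ring|].
    now apply Pd_mulx.
Qed.

(** The degree bounds are asymmetric so that [<= n] times [< m] gives exactly [< n + m], with no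
    truncated subtraction. *)
Lemma Pd_mult n m f g : Pd (S n) f -> Pd m g -> Pd (n + m) (fun x => f x * g x).
Proof.
  intros Hf Hg; revert f Hf; induction n as [|n IH]; intros f (c & h & Hh & E).
  - apply Pd_ext with (fun x => c * g x); [|now apply Pd_scal].
    intros x. simpl in Hh. rewrite E, Hh. simpl. ring.
  - apply Pd_ext with (fun x => c * (x ^ S n * g x) + h x * g x);
      [intros x; rewrite E; ring|].
    apply Pd_plus; [now apply Pd_scal, Pd_mulpow|].
    simpl. now apply Pd_S, IH.
Qed.

Lemma Pd_sum n m (c : nat -> R) (F : nat -> R -> R) :
  (forall i, (i <= m)%nat -> Pd n (F i)) ->
  Pd n (fun x => sum_f_R0 (fun i => c i * F i x) m).
Proof.
  induction m as [|m IH]; intros H; simpl.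
  - apply Pd_scal, H; lia.
  - apply Pd_plus; [apply IH; intros; apply H; lia|]. apply Pd_scal, H; lia.
Qed.

Lemma Pd_linear z : Pd 2 (fun x => x - z).
Proof.
  exists 1, (fun _ => - z). split; [apply Pd_const|]. intros; simpl; ring.
Qed.

Lemma Pd_continuous n f : Pd n f -> forall x, continuous f x.
Proof.
  revert f; induction n as [|n IH]; simpl; intros f.
  - intros H x. apply continuous_ext with (fun _ => 0); [easy|apply continuous_const].
  - intros (c & g & Hg & E) x.
    apply continuous_ext with (fun x => c * x ^ n + g x); [easy|].
    apply (continuous_plus (fun x => c * x ^ n) g); [|now apply IH].
    apply (ex_derive_continuous (fun x => c * x ^ n)). auto_derive; easy.
Qed.

Lemma pow_diff_factor n z : exists s, Pd n s /\ forall x, x ^ n = z ^ n + (x - z) * s x.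
Proof.
  induction n as [|n (s & Hs & E)].
  - exists (fun _ => 0). split; [easy|]. intros; simpl; ring.
  - exists (fun x => z ^ n + x * s x). split.
    + apply Pd_plus; [|now apply Pd_mulx].
      apply Pd_le with 1%nat; [lia|apply Pd_const].
    + intros x. simpl. rewrite E at 1. ring.
Qed.

(** The remainder of the division by [x - z] is the value [f z], so one statement serves both to
    split off a zero and, in [quotient_eval], to compare a polynomial with its value at a node. *)
Lemma Pd_factor n f z :
  Pd (S n) f -> exists q, Pd n q /\ forall x, f x = f z + (x - z) * q x.
Proof.
  revert f; induction n as [|n IH]; intros f (c & g & Hg & E).
  - exists (fun _ => 0). split; [easy|]. intros x. simpl in Hg.
    rewrite (E x), (E z), !Hg. simpl. ring.
  - destruct (IH g Hg) as (q & Hq & Eq).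
    destruct (pow_diff_factor (S n) z) as (s & Hs & Es).
    exists (fun x => c * s x + q x). split.
    + apply Pd_plus; [now apply Pd_scal|now apply Pd_S].
    + intros x. rewrite (E x), (E z), Es, (Eq x). ring.
Qed.

Lemma Pd_roots_zero n f (l : list R) :
  Pd n f -> NoDup l -> (n <= length l)%nat -> (forall y, In y l -> f y = 0) ->
  forall x, f x = 0.
Proof.
  revert f l; induction n as [|n IH]; intros f l Hf Hl Hn Hr; [exact Hf|].
  destruct l as [|z l]; [simpl in Hn; lia|].
  inversion_clear Hl as [|? ? Hz Hl'].
  destruct (Pd_factor n f z Hf) as (q & Hq & E).
  rewrite (Hr z (or_introl eq_refl)) in E.
  assert (Hq0 : forall x, q x = 0).
  { apply (IH q l Hq Hl'); [simpl in Hn; lia|].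
    intros y Hy. assert (Hfy := Hr y (or_intror Hy)). rewrite E in Hfy.
    assert (y - z <> 0) by (intros ?; apply Hz; now replace z with y by lra).
    nra. }
  intros x. rewrite E, Hq0. ring.
Qed.

(** Integrals see only [-1,1], while a polynomial is known to be nonzero somewhere on the whole
    line; finiteness of the zero set closes the gap. *)
Lemma Pd_nonzero_inside n f :
  Pd n f -> (exists x, f x <> 0) -> exists x, -1 < x < 1 /\ f x <> 0.
Proof.
  intros Hf (x0 & Hx0).
  destruct (classic (exists x, -1 < x < 1 /\ f x <> 0)) as [H|H]; [exact H|].
  exfalso; apply Hx0.
  (* The points [1 / (i + 2)] are [n] distinct elements of [(0, 1/2]]. *)
  apply (Pd_roots_zero n f (map (fun i => / (INR i + 2)) (seq 0 n)) Hf).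
  - apply Injective_map_NoDup; [|apply seq_NoDup].
    intros i j E. apply INR_eq.
    assert (0 <= INR i) by apply pos_INR. assert (0 <= INR j) by apply pos_INR.
    apply Rinv_eq_reg in E. lra.
  - now rewrite length_map, length_seq.
  - intros y Hy. apply in_map_iff in Hy. destruct Hy as (i & <- & _).
    assert (0 <= INR i) by apply pos_INR.
    apply NNPP. intros Hn. apply H. eexists; split; [|exact Hn]. split.
    + apply Rlt_trans with 0; [lra|]. apply Rinv_0_lt_compat; lra.
    + rewrite <- Rinv_1. apply Rinv_lt_contravar; lra.
Qed.

(** * Monic polynomials and their zeros *)

Definition monic (n : nat) (f : R -> R) : Prop := Pd n (fun x => f x - x ^ n).

Lemma monic_Pd n f : monic n f -> Pd (S n) f.
Proof. intros H. exists 1, (fun x => f x - x ^ n). split; [exact H|]. intros; ring. Qed.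

Lemma monic_ext n (f g : R -> R) : (forall x, f x = g x) -> monic n f -> monic n g.
Proof. intros E. apply Pd_ext. intros x. now rewrite E. Qed.

Lemma monic_mul_linear n f z : monic n f -> monic (S n) (fun x => (x - z) * f x).
Proof.
  intros H. unfold monic.
  apply Pd_ext with (fun x => x * (f x - x ^ n) + (- z) * f x); [intros; simpl; ring|].
  apply Pd_plus; [now apply Pd_mulx|]. now apply Pd_scal, monic_Pd.
Qed.

Lemma monic_plus n f r : monic n f -> Pd n r -> monic n (fun x => f x + r x).
Proof.
  intros Hf Hr. apply Pd_ext with (fun x => (f x - x ^ n) + r x); [intros; ring|].
  now apply Pd_plus.
Qed.

Lemma monic_pow_quotient n z :
  exists s, monic n s /\ forall x, x ^ S n = z ^ S n + (x - z) * s x.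
Proof.
  induction n as [|n (s & Hs & E)].
  - exists (fun _ => 1). split; [intros x; simpl; ring|]. intros; simpl; ring.
  - exists (fun x => z ^ S n + x * s x). split.
    + apply Pd_ext with (fun x => x * (s x - x ^ n) + z ^ S n); [intros; simpl; ring|].
      apply Pd_plus; [now apply Pd_mulx|].
      apply Pd_le with 1%nat; [lia|apply Pd_const].
    + intros x. change (x ^ S (S n)) with (x * x ^ S n). rewrite E at 1.
      simpl. ring.
Qed.

Lemma monic_factor n f z :
  monic (S n) f -> f z = 0 -> exists q, monic n q /\ forall x, f x = (x - z) * q x.
Proof.
  (* [Pd_factor] does not track leading coefficients, so it is applied to [f - x ^ S n]; the power
     contributes the monic part of the quotient. *)
  intros H Hz. destruct (Pd_factor n _ z H) as (q & Hq & E).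
  destruct (monic_pow_quotient n z) as (s & Hs & Es).
  exists (fun x => s x + q x). split; [now apply monic_plus|].
  intros x. specialize (E x). specialize (Es x). rewrite Hz in E. lra.
Qed.

Lemma monic_roots_length n f (l : list R) :
  monic n f -> NoDup l -> (forall y, In y l -> f y = 0) -> (length l <= n)%nat.
Proof.
  revert f l; induction n as [|n IH]; intros f l Hf Hl Hr;
    (destruct l as [|z l]; [simpl; lia|]).
  - assert (Hz := Hr z (or_introl eq_refl)). specialize (Hf z). simpl in Hf. lra.
  - inversion_clear Hl as [|? ? Hz Hl'].
    destruct (monic_factor n f z Hf (Hr z (or_introl eq_refl))) as (q & Hq & E).
    simpl. apply le_n_S, (IH q l Hq Hl').
    intros y Hy. assert (Hfy := Hr y (or_intror Hy)). rewrite E in Hfy.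
    assert (y - z <> 0) by (intros ?; apply Hz; now replace z with y by lra).
    nra.
Qed.

Lemma monic_nonzero n f : monic n f -> exists x, f x <> 0.
Proof.
  intros H. destruct (classic (exists x, f x <> 0)) as [?|Hn]; [assumption|exfalso].
  assert (H1 := monic_roots_length n f (map (fun i => INR i) (seq 0 (S n))) H).
  rewrite length_map, length_seq in H1.
  enough (S n <= n)%nat by lia. apply H1.
  - apply Injective_map_NoDup; [|apply seq_NoDup]. intros i j E; now apply INR_eq.
  - intros y _. apply NNPP. intros ?. apply Hn. now exists y.
Qed.

Definition prodroots (l : list R) (x : R) : R :=
  fold_right (fun z p => (x - z) * p) 1 l.

Lemma prodroots_monic l : monic (length l) (prodroots l).
Proof.
  induction l as [|z l IH]; [intros x; simpl; ring|].
  exact (monic_mul_linear _ _ z IH).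
Qed.

Lemma prodroots_app l1 l2 x : prodroots (l1 ++ l2) x = prodroots l1 x * prodroots l2 x.
Proof. induction l1 as [|z l IH]; simpl; [ring|]. rewrite IH. ring. Qed.

Lemma prodroots_root l x : prodroots l x = 0 <-> In x l.
Proof.
  induction l as [|z l IH]; simpl; [split; [lra|easy]|]. rewrite <- IH. split.
  - intros H. apply Rmult_integral in H. destruct H; [left; lra|now right].
  - intros [->|H]; [ring|]. rewrite H. ring.
Qed.

Lemma monic_prodroots n f l :
  monic n f -> NoDup l -> length l = n -> (forall y, In y l -> f y = 0) ->
  forall x, f x = prodroots l x.
Proof.
  intros Hf Hl Hn Hr x.
  enough (f x - prodroots l x = 0) by lra.
  apply (Pd_roots_zero n (fun x => f x - prodroots l x) l).
  - apply Pd_ext with (fun x => (f x - x ^ n) - (prodroots l x - x ^ n)); [intros; ring|].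
    apply Pd_minus; [exact Hf|]. rewrite <- Hn. apply prodroots_monic.
  - exact Hl.
  - lia.
  - intros y Hy. rewrite (Hr y Hy). apply prodroots_root in Hy. lra.
Qed.

(* The list collects the points of (-1,1) where [f] changes sign. *)
Lemma Pd_sign_changes n f :
  Pd n f ->
  exists l, NoDup l /\ (forall y, In y l -> -1 < y < 1 /\ f y = 0) /\
    ((forall x, -1 <= x <= 1 -> 0 <= f x * prodroots l x) \/
     (forall x, -1 <= x <= 1 -> f x * prodroots l x <= 0)).
Proof.
  revert f; induction n as [|n IH]; intros f Hf.
  { exists nil. repeat split; [constructor|easy|easy|easy|].
    left. intros x _. simpl in Hf. rewrite Hf. lra. }
  destruct (classic (exists z, -1 < z < 1 /\ f z = 0)) as [(z & Hz & Hfz)|Hno].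
  - destruct (Pd_factor n f z Hf) as (q & Hq & E). rewrite Hfz in E.
    destruct (IH q Hq) as (l & Hl & Hr & Hs).
    assert (Hr' : forall y, In y l -> -1 < y < 1 /\ f y = 0).
    { intros y Hy. destruct (Hr y Hy) as (Hy1 & Hy2). split; [exact Hy1|].
      rewrite E, Hy2. ring. }
    (* Multiplying by [x - z] toggles the sign change at [z]: if [q] changes sign there, [f] does
       not and [z] leaves the list; otherwise [z] enters it, and the square [(x - z) ^ 2] preserves
       the sign. *)
    destruct (classic (In z l)) as [Hin|Hin].
    + apply in_split in Hin. destruct Hin as (l1 & l2 & ->).
      exists (l1 ++ l2). split; [now apply NoDup_remove_1 in Hl|]. split.
      { intros y Hy. apply Hr'. apply in_app_iff in Hy. apply in_app_iff.
        simpl. tauto. }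
      assert (E' : forall x, f x * prodroots (l1 ++ l2) x
                             = q x * prodroots (l1 ++ z :: l2) x).
      { intros x. rewrite E, !prodroots_app. simpl. ring. }
      destruct Hs as [Hs|Hs]; [left|right]; intros x Hx; rewrite E'; auto.
    + exists (z :: l). split; [now constructor|]. split.
      { intros y [<-|Hy]; auto. }
      assert (E' : forall x, f x * prodroots (z :: l) x
                             = (x - z) ^ 2 * (q x * prodroots l x)).
      { intros x. rewrite E. simpl. ring. }
      destruct Hs as [Hs|Hs]; [left|right]; intros x Hx; rewrite E';
        specialize (Hs x Hx); assert (H2 := pow2_ge_0 (x - z)); nra.
  - exists nil. split; [constructor|]. split; [easy|]. simpl.
    (* no zero in the open interval: by IVT [f] has a constant sign *)
    assert (Hc : forall x y, -1 <= x <= 1 -> -1 <= y <= 1 -> 0 < f x -> f y < 0 -> False).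
    { intros x y Hx Hy Hfx Hfy.
      assert (Hcont : continuity f).
      { intros t. apply continuity_pt_filterlim. now apply (Pd_continuous (S n)). }
      destruct (Rtotal_order x y) as [Hxy|[->|Hxy]]; [|lra|].
      - destruct (IVT (fun t => - f t) x y) as (z & Hz & Hfz).
        + intros t. apply continuity_pt_opp. apply Hcont.
        + exact Hxy.
        + lra.
        + lra.
        + apply Hno. exists z. assert (f z = 0) by lra.
          assert (z <> x) by (intros ->; lra). assert (z <> y) by (intros ->; lra).
          split; [lra|assumption].
      - destruct (IVT f y x Hcont Hxy Hfy Hfx) as (z & Hz & Hfz).
        apply Hno. exists z.
        assert (z <> x) by (intros ->; lra). assert (z <> y) by (intros ->; lra).
        split; [lra|assumption]. }
    destruct (classic (exists x, -1 <= x <= 1 /\ 0 < f x)) as [(x & Hx & Hfx)|Hn].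
    + left. intros y Hy. destruct (Rlt_le_dec (f y) 0) as [H|H]; [|lra].
      exfalso. exact (Hc x y Hx Hy Hfx H).
    + right. intros y Hy. destruct (Rle_lt_dec (f y) 0) as [H|H]; [lra|].
      exfalso. apply Hn. now exists y.
Qed.

(** * Integration against the weights *)

Definition poly (f : R -> R) : Prop := exists n, Pd n f.

Lemma Pd_poly n f : Pd n f -> poly f.
Proof. now exists n. Qed.

Lemma poly_id : poly (fun x => x).
Proof. exists 2%nat. apply Pd_ext with (fun x => x - 0); [intros; ring|apply Pd_linear]. Qed.

Lemma poly_const c : poly (fun _ => c).
Proof. exists 1%nat. apply Pd_const. Qed.

Lemma poly_plus f g : poly f -> poly g -> poly (fun x => f x + g x).
Proof.
  intros (n & Hf) (m & Hg). exists (n + m)%nat.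
  apply Pd_plus; eapply Pd_le; [|exact Hf| |exact Hg]; lia.
Qed.

Lemma poly_mult f g : poly f -> poly g -> poly (fun x => f x * g x).
Proof.
  intros (n & Hf) (m & Hg). exists (n + m)%nat.
  apply Pd_mult; [now apply Pd_S|exact Hg].
Qed.

Lemma poly_opp f : poly f -> poly (fun x => - f x).
Proof.
  intros (n & Hf). exists n.
  apply Pd_ext with (fun x => (-1) * f x); [intros; ring|now apply Pd_scal].
Qed.

Lemma poly_minus f g : poly f -> poly g -> poly (fun x => f x - g x).
Proof. intros Hf Hg. apply (poly_plus f (fun x => - g x) Hf). now apply poly_opp. Qed.

Lemma poly_pow f n : poly f -> poly (fun x => f x ^ n).
Proof.
  intros Hf. induction n as [|n IH]; [exact (poly_const 1)|].
  exact (poly_mult _ _ Hf IH).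
Qed.

Lemma poly_continuous f : poly f -> forall x, continuous f x.
Proof. intros (n & Hf). now apply Pd_continuous with n. Qed.

Ltac polyt :=
  repeat first
    [ assumption
    | match goal with H : Pd _ ?f |- poly ?f => exact (Pd_poly _ _ H) end
    | apply poly_id
    | apply poly_const
    | apply poly_plus
    | apply poly_minus
    | apply poly_opp
    | apply poly_mult
    | apply poly_pow ].

Lemma one_plus_pos a x : -1 < a < 1 -> -1 <= x <= 1 -> 0 < 1 + a * x.
Proof. intros Ha Hx. destruct (Rle_lt_dec 0 a); destruct (Rle_lt_dec 0 x); nra. Qed.

Lemma weight_pos p a x : -1 < a < 1 -> -1 <= x <= 1 -> 0 < weight p a x.
Proof. intros Ha Hx. apply Rinv_0_lt_compat, pow_lt, one_plus_pos; assumption. Qed.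

Lemma weight_S p a x :
  -1 < a < 1 -> -1 <= x <= 1 -> weight p a x = (1 + a * x) * weight (S p) a x.
Proof.
  intros Ha Hx. assert (H := one_plus_pos a x Ha Hx). unfold weight. simpl.
  field. split; [apply pow_nonzero|]; lra.
Qed.

Lemma weight_continuous p a x :
  -1 < a < 1 -> -1 <= x <= 1 -> continuous (weight p a) x.
Proof.
  intros Ha Hx. assert (H := one_plus_pos a x Ha Hx).
  apply (ex_derive_continuous (weight p a)). unfold weight. auto_derive.
  apply pow_nonzero; lra.
Qed.

Definition L (p : nat) (a : R) (f : R -> R) : R :=
  RInt (fun x => f x * weight p a x) (-1) 1.

Lemma integrand_continuous p a f x :
  -1 < a < 1 -> poly f -> -1 <= x <= 1 -> continuous (fun x => f x * weight p a x) x.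
Proof.
  intros Ha Hf Hx. apply (continuous_mult f (weight p a)).
  - now apply poly_continuous.
  - now apply weight_continuous.
Qed.

Lemma L_ex p a f : -1 < a < 1 -> poly f -> ex_RInt (fun x => f x * weight p a x) (-1) 1.
Proof.
  intros Ha Hf. apply (ex_RInt_continuous (V := R_CompleteNormedModule)).
  intros z Hz. rewrite Rmin_left, Rmax_right in Hz by lra.
  now apply integrand_continuous.
Qed.

Lemma L_ext p a f g : (forall x, -1 < x < 1 -> f x = g x) -> L p a f = L p a g.
Proof.
  intros E. apply RInt_ext. intros x Hx. rewrite Rmin_left, Rmax_right in Hx by lra.
  now rewrite E.
Qed.

Lemma Int_RInt (f : R -> R) : ex_RInt f (-1) 1 -> Int f = RInt f (-1) 1.
Proof.
  intros H. apply ex_RInt_Reals_0 in H. unfold Int.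
  destruct (epsilon_spec (inhabits 0)
    (fun I => exists pr : Riemann_integrable f (-1) 1, RiemannInt pr = I)) as (pr & E).
  - now exists (RiemannInt H), H.
  - rewrite <- E. symmetry. apply RInt_Reals.
Qed.

Lemma Int_L p a f g :
  -1 < a < 1 -> poly f -> (forall x, g x = f x * weight p a x) -> Int g = L p a f.
Proof.
  intros Ha Hf E. assert (Hex := L_ex p a f Ha Hf).
  rewrite Int_RInt.
  - apply RInt_ext. intros; apply E.
  - apply ex_RInt_ext with (2 := Hex). intros; now rewrite E.
Qed.

Lemma L_plus p a f g : -1 < a < 1 -> poly f -> poly g ->
  L p a (fun x => f x + g x) = L p a f + L p a g.
Proof.
  intros Ha Hf Hg. unfold L.
  rewrite <- (RInt_plus (V := R_CompleteNormedModule)); try now apply L_ex.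
  apply RInt_ext. intros x _. unfold plus; simpl. ring.
Qed.

Lemma L_scal p a c f : -1 < a < 1 -> poly f -> L p a (fun x => c * f x) = c * L p a f.
Proof.
  intros Ha Hf. unfold L.
  rewrite <- (RInt_scal (V := R_CompleteNormedModule) _ (-1) 1 c) by now apply L_ex.
  apply RInt_ext. intros x _. unfold scal; simpl. unfold mult; simpl. ring.
Qed.

Lemma L_zero p a : L p a (fun _ => 0) = 0.
Proof.
  unfold L. rewrite (RInt_ext _ (fun _ => 0)) by (intros; simpl; ring).
  rewrite RInt_const. unfold scal; simpl; unfold mult; simpl. ring.
Qed.

Lemma L_minus p a f g : -1 < a < 1 -> poly f -> poly g ->
  L p a (fun x => f x - g x) = L p a f - L p a g.
Proof.
  intros Ha Hf Hg. rewrite (L_ext _ _ _ (fun x => f x + (-1) * g x)) by (intros; ring).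
  rewrite L_plus, L_scal; try assumption; [ring|]. polyt.
Qed.

Lemma L_sum p a n c (F : nat -> R -> R) : -1 < a < 1 ->
  (forall i, (i <= n)%nat -> poly (F i)) ->
  L p a (fun x => sum_f_R0 (fun i => c i * F i x) n)
  = sum_f_R0 (fun i => c i * L p a (F i)) n.
Proof.
  intros Ha; induction n as [|n IH]; intros HF; simpl.
  - apply L_scal; [assumption|]. apply HF; lia.
  - rewrite L_plus, L_scal, IH; try assumption; try (apply HF; lia).
    + reflexivity.
    + intros; apply HF; lia.
    + clear IH. induction n as [|n IH]; simpl.
      * apply poly_mult; [apply poly_const|apply HF; lia].
      * apply poly_plus; [apply IH; intros; apply HF; lia|].
        apply poly_mult; [apply poly_const|apply HF; lia].
    + apply poly_mult; [apply poly_const|apply HF; lia].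
Qed.

(** A factor [1 + a x] is the price of raising the exponent by one. This links exponent 4 with 5 in
    the matrix entries, and [p] with [S p] in the Markov argument. *)
Lemma L_weight_S p a f : -1 < a < 1 ->
  L p a f = L (S p) a (fun x => (1 + a * x) * f x).
Proof.
  intros Ha. apply RInt_ext. intros x Hx. rewrite Rmin_left, Rmax_right in Hx by lra.
  rewrite (weight_S p a x Ha) by lra. simpl. ring.
Qed.

(** By continuity the integrand stays above half its value at [x0] on a small interval around it,
    and it is nonnegative elsewhere. *)
Lemma L_pos p a f : -1 < a < 1 -> poly f -> (forall x, -1 <= x <= 1 -> 0 <= f x) ->
  (exists x, f x <> 0) -> 0 < L p a f.
Proof.
  intros Ha (n & Hf) Hpos Hnz.
  destruct (Pd_nonzero_inside n f Hf Hnz) as (x0 & Hx0 & Hfx0).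
  assert (Hp := Pd_poly n f Hf).
  set (g := fun x => f x * weight p a x).
  assert (Hg : forall x, -1 <= x <= 1 -> 0 <= g x).
  { intros x Hx. apply Rmult_le_pos; [now apply Hpos|].
    apply Rlt_le, weight_pos; assumption. }
  assert (Hg0 : 0 < g x0).
  { apply Rmult_lt_0_compat; [|apply weight_pos; lra].
    specialize (Hpos x0). lra. }
  assert (Hc : continuous g x0) by (apply integrand_continuous; [assumption|assumption|lra]).
  assert (Hm : 0 < g x0 / 2) by lra.
  apply continuity_pt_filterlim in Hc.
  destruct (Hc (g x0 / 2) Hm) as (d & Hd & Hloc).
  set (e := Rmin (d / 2) (Rmin ((x0 + 1) / 2) ((1 - x0) / 2))).
  assert (He : 0 < e /\ e <= d / 2 /\ e <= (x0 + 1) / 2 /\ e <= (1 - x0) / 2).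
  { unfold e. split.
    - repeat apply Rmin_glb_lt; lra.
    - split; [apply Rmin_l|]. split; eapply Rle_trans;
        [apply Rmin_r|apply Rmin_l|apply Rmin_r|apply Rmin_r]. }
  assert (Hex : forall u v, -1 <= u <= 1 -> -1 <= v <= 1 -> ex_RInt g u v).
  { intros u v Hu Hv. apply (ex_RInt_continuous (V := R_CompleteNormedModule)).
    intros z Hz. apply integrand_continuous; try assumption.
    split; [eapply Rle_trans; [|apply Hz]; apply Rmin_glb; lra|].
    eapply Rle_trans; [apply Hz|]. apply Rmax_lub; lra. }
  unfold L. fold g.
  rewrite <- (RInt_Chasles g (-1) (x0 - e) 1) by (apply Hex; lra).
  rewrite <- (RInt_Chasles g (x0 - e) (x0 + e) 1) by (apply Hex; lra).
  assert (H1 : 0 <= RInt g (-1) (x0 - e)).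
  { apply RInt_ge_0; [lra|apply Hex; lra|]. intros; apply Hg; lra. }
  assert (H3 : 0 <= RInt g (x0 + e) 1).
  { apply RInt_ge_0; [lra|apply Hex; lra|]. intros; apply Hg; lra. }
  assert (H2 : 2 * e * (g x0 / 2) <= RInt g (x0 - e) (x0 + e)).
  { replace (2 * e * (g x0 / 2)) with (RInt (fun _ => g x0 / 2) (x0 - e) (x0 + e)).
    2:{ rewrite RInt_const. unfold scal; simpl; unfold mult; simpl. ring. }
    apply RInt_le; [lra|apply ex_RInt_const|apply Hex; lra|].
    intros x Hx. destruct (Req_dec x x0) as [->|Hne]; [lra|].
    assert (Hdx := Hloc x).
    assert (R_dist (g x) (g x0) < g x0 / 2).
    { apply Hdx. split; [split; [exact I|now apply not_eq_sym]|].
      simpl; unfold R_dist. apply Rabs_def1; lra. }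
    unfold R_dist in H. apply Rabs_def2 in H. lra. }
  unfold plus; simpl. assert (0 < e * g x0) by (apply Rmult_lt_0_compat; lra). lra.
Qed.

Lemma L_sqr_pos p a f : -1 < a < 1 -> poly f -> (exists x, f x <> 0) ->
  0 < L p a (fun x => f x * f x).
Proof.
  intros Ha Hf (x & Hx). apply L_pos; [assumption|polyt| |].
  - intros y _. nra.
  - exists x. nra.
Qed.

(** * Polynomials depending on the parameter *)

Lemma weight_is_derive p b x :
  1 + b * x <> 0 ->
  is_derive (fun b => weight p b x) b (- INR p * x * weight (S p) b x).
Proof.
  intros H. unfold weight. auto_derive; [now apply pow_nonzero|].
  assert (Hp := pow_nonzero _ p H).
  destruct p as [|p]; [simpl; field; assumption|].
  change (Init.Nat.pred (S p)) with p.
  assert (Hp' := pow_nonzero _ p H).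
  change ((1 + b * x) ^ S (S p)) with ((1 + b * x) * ((1 + b * x) * (1 + b * x) ^ p)).
  change ((1 + b * x) ^ S p) with ((1 + b * x) * (1 + b * x) ^ p).
  field. split; assumption.
Qed.

Lemma continuity_2d_pt_pow (f : R -> R -> R) n x y :
  continuity_2d_pt f x y -> continuity_2d_pt (fun u v => f u v ^ n) x y.
Proof.
  intros Hf. induction n as [|n IH]; simpl; [apply continuity_2d_pt_const|].
  now apply continuity_2d_pt_mult.
Qed.

Lemma locally_unit a : -1 < a < 1 -> locally a (fun b => -1 < b < 1).
Proof.
  intros Ha. apply (locally_interval (fun b => -1 < b < 1) a (-1) 1); simpl; intros; lra.
Qed.

(** Differentiation under the integral sign, legitimate because [1 + u v] stays away from 0 for [u]
    near [a] and [v] in [-1,1]. Each derivative raises the exponent by one and brings a factor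
    [x]. *)
Lemma moment_is_derive p a n :
  -1 < a < 1 ->
  is_derive (fun b => L p b (fun x => x ^ n)) a
    (- INR p * L (S p) a (fun x => x * x ^ n)).
Proof.
  intros Ha.
  assert (HU := locally_unit a Ha).
  replace (- INR p * L (S p) a (fun x => x * x ^ n))
    with (RInt (fun x => Derive (fun b => x ^ n * weight p b x) a) (-1) 1).
  - apply (is_derive_RInt_param (fun b x => x ^ n * weight p b x)).
    + revert HU. apply filter_imp. intros b Hb x Hx.
      rewrite Rmin_left, Rmax_right in Hx by lra.
      apply (ex_derive_scal (fun b => weight p b x)).
      eexists. apply weight_is_derive. assert (H := one_plus_pos b x Hb Hx). lra.
    + intros x Hx. rewrite Rmin_left, Rmax_right in Hx by lra.
      assert (Hc : continuity_2d_pt (fun u v => 1 + u * v) a x).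
      { apply continuity_2d_pt_plus; [apply continuity_2d_pt_const|].
        apply continuity_2d_pt_mult; [apply continuity_2d_pt_id1|apply continuity_2d_pt_id2]. }
      assert (H := one_plus_pos a x Ha Hx).
      apply continuity_2d_pt_ext_loc
        with (fun u v => v ^ n * (- INR p * v * weight (S p) u v)).
      * assert (Hnz : locally_2d (fun u v => 1 + u * v <> 0) a x)
          by (apply continuity_2d_pt_neq_0; [exact Hc|lra]).
        revert Hnz. apply locally_2d_impl, locally_2d_forall. intros u v Huv.
        symmetry. apply is_derive_unique.
        apply (is_derive_scal (fun b => weight p b v) u (v ^ n)).
        now apply weight_is_derive.
      * repeat apply continuity_2d_pt_mult; try apply continuity_2d_pt_const;
          try apply continuity_2d_pt_pow; try apply continuity_2d_pt_id2.
        unfold weight. apply continuity_2d_pt_inv.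
        -- now apply continuity_2d_pt_pow.
        -- apply pow_nonzero. lra.
    + revert HU. apply filter_imp. intros b Hb.
      apply (L_ex p b (fun x => x ^ n) Hb). polyt.
  - rewrite <- L_scal; [|assumption|polyt].
    apply RInt_ext. intros x Hx. rewrite Rmin_left, Rmax_right in Hx by lra.
    rewrite (is_derive_unique _ a (x ^ n * (- INR p * x * weight (S p) a x))).
    + simpl. ring.
    + apply (is_derive_scal (fun b => weight p b x) a (x ^ n)).
      apply weight_is_derive.
      assert (H := one_plus_pos a x Ha ltac:(lra)). lra.
Qed.

(* [F b] is, for each parameter [b] in (-1,1), a polynomial of degree [< n]
   whose coefficients are differentiable in [b]; [dF] is the [b]-derivative. *)
Fixpoint SP (n : nat) (F dF : R -> R -> R) : Prop :=
  match n with
  | O => forall b, -1 < b < 1 -> forall x, F b x = 0 /\ dF b x = 0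
  | S n => exists (c dc : R -> R) (G dG : R -> R -> R),
      (forall b, -1 < b < 1 -> is_derive c b (dc b)) /\ SP n G dG /\
      forall b, -1 < b < 1 -> forall x,
        F b x = c b * x ^ n + G b x /\ dF b x = dc b * x ^ n + dG b x
  end.

Lemma SP_ext n (F dF F' dF' : R -> R -> R) :
  (forall b x, -1 < b < 1 -> F b x = F' b x) ->
  (forall b x, -1 < b < 1 -> dF b x = dF' b x) -> SP n F dF -> SP n F' dF'.
Proof.
  intros E dE. destruct n as [|n]; simpl.
  - intros H b Hb x. rewrite <- E, <- dE by assumption. now apply H.
  - intros (c & dc & G & dG & Hc & HG & H). exists c, dc, G, dG.
    split; [exact Hc|split; [exact HG|]]. intros b Hb x.
    rewrite <- E, <- dE by assumption. now apply H.
Qed.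

Lemma SP_zero n : SP n (fun _ _ => 0) (fun _ _ => 0).
Proof.
  induction n as [|n IH]; simpl; [easy|].
  exists (fun _ => 0), (fun _ => 0), (fun _ _ => 0), (fun _ _ => 0).
  split; [|split; [assumption|intros; split; ring]].
  intros b _. apply (is_derive_const (K := R_AbsRing) (V := R_NormedModule)).
Qed.

Lemma SP_S n F dF : SP n F dF -> SP (S n) F dF.
Proof.
  intros H. exists (fun _ => 0), (fun _ => 0), F, dF.
  split; [|split; [assumption|intros; split; ring]].
  intros b _. apply (is_derive_const (K := R_AbsRing) (V := R_NormedModule)).
Qed.

Lemma SP_plus n F dF G dG :
  SP n F dF -> SP n G dG ->
  SP n (fun b x => F b x + G b x) (fun b x => dF b x + dG b x).
Proof.
  revert F dF G dG; induction n as [|n IH]; intros F dF G dG; simpl.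
  - intros HF HG b Hb x. destruct (HF b Hb x) as (-> & ->).
    destruct (HG b Hb x) as (-> & ->). split; ring.
  - intros (c & dc & F' & dF' & Hc & HF & E) (c' & dc' & G' & dG' & Hc' & HG & E').
    exists (fun b => c b + c' b), (fun b => dc b + dc' b),
      (fun b x => F' b x + G' b x), (fun b x => dF' b x + dG' b x).
    split; [|split].
    + intros b Hb. apply (is_derive_plus c c'); [now apply Hc|now apply Hc'].
    + now apply IH.
    + intros b Hb x. destruct (E b Hb x) as (-> & ->).
      destruct (E' b Hb x) as (-> & ->). split; ring.
Qed.

Lemma SP_scal n (s ds : R -> R) F dF :
  (forall b, -1 < b < 1 -> is_derive s b (ds b)) -> SP n F dF ->
  SP n (fun b x => s b * F b x) (fun b x => ds b * F b x + s b * dF b x).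
Proof.
  intros Hs; revert F dF; induction n as [|n IH]; intros F dF; simpl.
  - intros HF b Hb x. destruct (HF b Hb x) as (-> & ->). split; ring.
  - intros (c & dc & F' & dF' & Hc & HF & E).
    exists (fun b => s b * c b), (fun b => ds b * c b + s b * dc b),
      (fun b x => s b * F' b x), (fun b x => ds b * F' b x + s b * dF' b x).
    split; [|split].
    + intros b Hb.
      apply (is_derive_mult s c b (ds b) (dc b)); [now apply Hs|now apply Hc|].
      intros; apply Rmult_comm.
    + now apply IH.
    + intros b Hb x. destruct (E b Hb x) as (-> & ->). split; ring.
Qed.

Lemma SP_scal_const n (s : R) F dF :
  SP n F dF -> SP n (fun b x => s * F b x) (fun b x => s * dF b x).
Proof.
  intros HF. eapply SP_ext; [| |apply (SP_scal n (fun _ => s) (fun _ => 0) F dF)].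
  - intros; reflexivity.
  - intros; simpl; ring.
  - intros b _. apply (is_derive_const (K := R_AbsRing) (V := R_NormedModule)).
  - exact HF.
Qed.

Lemma SP_mulx n F dF :
  SP n F dF -> SP (S n) (fun b x => x * F b x) (fun b x => x * dF b x).
Proof.
  revert F dF; induction n as [|n IH]; intros F dF HF.
  - apply SP_ext with (fun _ _ => 0) (fun _ _ => 0); [| |apply SP_zero];
      intros b x Hb; destruct (HF b Hb x) as (E & dE); rewrite ?E, ?dE; ring.
  - destruct HF as (c & dc & F' & dF' & Hc & HF & E).
    exists c, dc, (fun b x => x * F' b x), (fun b x => x * dF' b x).
    split; [exact Hc|split; [now apply IH|]].
    intros b Hb x. destruct (E b Hb x) as (-> & ->). simpl. split; ring.
Qed.

Lemma SP_mulpow k n F dF :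
  SP n F dF -> SP (k + n) (fun b x => x ^ k * F b x) (fun b x => x ^ k * dF b x).
Proof.
  intros HF; induction k as [|k IH].
  - simpl plus. apply SP_ext with F dF; [| |exact HF]; intros; simpl; ring.
  - simpl plus. apply SP_mulx in IH. revert IH. apply SP_ext; intros; simpl; ring.
Qed.

Lemma SP_mult n m F dF G dG :
  SP n F dF -> SP m G dG ->
  SP (n + m) (fun b x => F b x * G b x) (fun b x => dF b x * G b x + F b x * dG b x).
Proof.
  intros HF HG; revert F dF HF; induction n as [|n IH]; intros F dF HF.
  - apply SP_ext with (fun _ _ => 0) (fun _ _ => 0); [| |apply SP_zero];
      intros b x Hb; destruct (HF b Hb x) as (E & dE); rewrite ?E, ?dE; ring.
  - destruct HF as (c & dc & F' & dF' & Hc & HF & E).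
    assert (H1 := SP_scal _ c dc _ _ Hc (SP_mulpow n m G dG HG)).
    assert (H2 := SP_plus _ _ _ _ _ H1 (IH F' dF' HF)).
    apply SP_S in H2. revert H2. apply SP_ext; intros b x Hb;
      destruct (E b Hb x) as (E1 & E2); rewrite ?E2, E1; ring.
Qed.

Lemma SP_pow n : SP (S n) (fun _ x => x ^ n) (fun _ _ => 0).
Proof.
  exists (fun _ => 1), (fun _ => 0), (fun _ _ => 0), (fun _ _ => 0).
  split; [|split; [apply SP_zero|intros; split; ring]].
  intros b _. apply (is_derive_const (K := R_AbsRing) (V := R_NormedModule)).
Qed.

Lemma SP_fixed n f : Pd n f -> SP n (fun _ => f) (fun _ _ => 0).
Proof.
  revert f; induction n as [|n IH]; intros f Hf.
  - intros b _ x. simpl in Hf. now rewrite Hf.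
  - destruct Hf as (c & g & Hg & E).
    exists (fun _ => c), (fun _ => 0), (fun _ => g), (fun _ _ => 0).
    split; [|split; [now apply IH|intros; rewrite E; split; ring]].
    intros b _. apply (is_derive_const (K := R_AbsRing) (V := R_NormedModule)).
Qed.

Lemma SP_Pd n F dF b : -1 < b < 1 -> SP n F dF -> Pd n (F b) /\ Pd n (dF b).
Proof.
  intros Hb; revert F dF; induction n as [|n IH]; intros F dF HF.
  - split; intros x; now apply HF.
  - destruct HF as (c & dc & G & dG & Hc & HG & E).
    destruct (IH G dG HG) as (H1 & H2). split.
    + exists (c b), (G b). split; [exact H1|]. intros x; now apply E.
    + exists (dc b), (dG b). split; [exact H2|]. intros x; now apply E.
Qed.

(** Product rule: the parameter enters through the coefficients, giving [dF], and through the
    weight, giving the term of exponent [S p]. Working coefficient by coefficient leaves only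
    monomials to differentiate under the integral sign. *)
Lemma SP_L_derive p n F dF a :
  -1 < a < 1 -> SP n F dF ->
  is_derive (fun b => L p b (F b)) a
    (L p a (dF a) - INR p * L (S p) a (fun x => x * F a x)).
Proof.
  intros Ha; revert F dF; induction n as [|n IH]; intros F dF HF.
  - apply is_derive_ext_loc with (fun _ => 0).
    + generalize (locally_unit a Ha). apply filter_imp. intros b Hb.
      rewrite (L_ext p b _ (fun _ => 0)); [now rewrite L_zero|].
      intros x _. now apply HF.
    + rewrite (L_ext p a (dF a) (fun _ => 0)), L_zero by (intros; now apply HF).
      rewrite (L_ext (S p) a _ (fun _ => 0)), L_zero
        by (intros x _; destruct (HF a Ha x) as (-> & _); ring).
      replace (0 - INR p * 0) with 0 by ring.
      apply (is_derive_const (K := R_AbsRing) (V := R_NormedModule)).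
  - destruct HF as (c & dc & G & dG & Hc & HG & E).
    apply is_derive_ext_loc with (fun b => c b * L p b (fun x => x ^ n) + L p b (G b)).
    + generalize (locally_unit a Ha). apply filter_imp. intros b Hb.
      destruct (SP_Pd n G dG b Hb HG) as (HGb & _).
      rewrite (L_ext p b (F b) (fun x => c b * x ^ n + G b x)) by (intros; now apply E).
      rewrite L_plus, L_scal; try assumption; try polyt. reflexivity.
    + destruct (SP_Pd n G dG a Ha HG) as (HGa & HdGa).
      rewrite (L_ext p a (dF a) (fun x => dc a * x ^ n + dG a x)) by (intros; now apply E).
      rewrite (L_ext (S p) a _ (fun x => c a * (x * x ^ n) + x * G a x))
        by (intros x _; destruct (E a Ha x) as (-> & _); ring).
      rewrite !L_plus, !L_scal; try assumption; try polyt.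
      replace (dc a * L p a (fun x => x ^ n) + L p a (dG a) -
        INR p * (c a * L (S p) a (fun x => x * x ^ n) + L (S p) a (fun x => x * G a x)))
      with ((dc a * L p a (fun x => x ^ n)
             + c a * (- INR p * L (S p) a (fun x => x * x ^ n)))
            + (L p a (dG a) - INR p * L (S p) a (fun x => x * G a x))) by ring.
      apply (is_derive_plus (fun b => c b * L p b (fun x => x ^ n))); [|now apply IH].
      apply (is_derive_mult c (fun b => L p b (fun x => x ^ n)) a (dc a)).
      * now apply Hc.
      * now apply moment_is_derive.
      * intros; apply Rmult_comm.
Qed.

(** Because [c a = 0], the difference quotient is that of [c] times [h (a + t)], so continuity of
    [h] suffices. This is how a merely continuous branch of zeros acquires a derivative. *)
Lemma is_derive_mult_vanishing (c h : R -> R) a l :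
  is_derive c a l -> c a = 0 -> continuous h a ->
  is_derive (fun b => c b * h b) a (l * h a).
Proof.
  intros Hc Ha Hh. apply is_derive_Reals. apply is_derive_Reals in Hc.
  apply continuity_pt_filterlim in Hh.
  intros eps Heps.
  assert (Hl := Rabs_pos l). assert (Hha := Rabs_pos (h a)).
  set (M := 1 + Rabs l + Rabs (h a)).
  (* The error is at most [e * e + e * Rabs (h a) + Rabs l * e], hence at most [e * M] because
     [e <= 1]. *)
  set (e := Rmin 1 (eps / (2 * M))).
  assert (HM : 0 < M) by (unfold M; lra).
  assert (He : 0 < e).
  { apply Rmin_glb_lt; [lra|]. apply Rdiv_lt_0_compat; lra. }
  assert (He1 : e <= 1) by apply Rmin_l.
  assert (HeM : e * M < eps).
  { apply Rle_lt_trans with (eps / (2 * M) * M).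
    - apply Rmult_le_compat_r; [lra|apply Rmin_r].
    - replace (eps / (2 * M) * M) with (eps / 2) by (field; lra). lra. }
  destruct (Hc e He) as (d1 & Hd1). destruct (Hh e He) as (d2 & Hd2 & Hd2').
  assert (Hd : 0 < Rmin d1 d2) by (apply Rmin_glb_lt; [apply cond_pos|exact Hd2]).
  exists (mkposreal _ Hd). simpl. intros t Ht Htd.
  assert (H1 : Rabs ((c (a + t) - c a) / t - l) < e).
  { apply Hd1; [exact Ht|]. eapply Rlt_le_trans; [exact Htd|apply Rmin_l]. }
  assert (H2 : Rabs (h (a + t) - h a) < e).
  { apply (Hd2' (a + t)). split; [split; [exact I|lra]|].
    simpl; unfold R_dist. replace (a + t - a) with t by ring.
    eapply Rlt_le_trans; [exact Htd|apply Rmin_r]. }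
  rewrite Ha in *.
  set (Q := (c (a + t) - 0) / t) in *. set (H' := h (a + t)) in *.
  replace ((c (a + t) * H' - 0 * h a) / t - l * h a)
    with ((Q - l) * (H' - h a) + ((Q - l) * h a + l * (H' - h a)))
    by (unfold Q; field; exact Ht).
  eapply Rle_lt_trans; [apply Rabs_triang|].
  assert (H3 := Rabs_triang ((Q - l) * h a) (l * (H' - h a))).
  rewrite !Rabs_mult in *.
  assert (H4 := Rabs_pos (Q - l)). assert (H5 := Rabs_pos (H' - h a)).
  unfold M in HeM. nra.
Qed.

(** Subtracting [F a] at the same moving point [lm b] leaves a sum of coefficient increments, each
    vanishing at [b = a], times powers of [lm b], so [lm] only has to be continuous. *)
Lemma SP_compose_derive n F dF a (lm : R -> R) :
  -1 < a < 1 -> SP n F dF -> continuous lm a ->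
  is_derive (fun b => F b (lm b) - F a (lm b)) a (dF a (lm a)).
Proof.
  intros Ha HF Hlm; revert F dF HF; induction n as [|n IH]; intros F dF HF.
  - destruct (HF a Ha (lm a)) as (_ & ->).
    apply is_derive_ext_loc with (fun _ => 0).
    + generalize (locally_unit a Ha). apply filter_imp. intros b Hb.
      destruct (HF b Hb (lm b)) as (-> & _). destruct (HF a Ha (lm b)) as (-> & _). simpl; ring.
    + apply (is_derive_const (K := R_AbsRing) (V := R_NormedModule)).
  - destruct HF as (c & dc & G & dG & Hc & HG & E).
    destruct (E a Ha (lm a)) as (_ & ->).
    apply is_derive_ext_loc
      with (fun b => (c b - c a) * lm b ^ n + (G b (lm b) - G a (lm b))).
    + generalize (locally_unit a Ha). apply filter_imp. intros b Hb.
      destruct (E b Hb (lm b)) as (-> & _). destruct (E a Ha (lm b)) as (-> & _). simpl; ring.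
    + apply (is_derive_plus (fun b => (c b - c a) * lm b ^ n)); [|now apply IH].
      apply (is_derive_mult_vanishing (fun b => c b - c a) (fun b => lm b ^ n)).
      * replace (dc a) with (dc a - 0) by ring.
        apply (is_derive_minus c (fun _ => c a)); [now apply Hc|].
        apply (is_derive_const (K := R_AbsRing) (V := R_NormedModule)).
      * ring.
      * apply (continuous_comp lm (fun y => y ^ n)); [exact Hlm|].
        apply poly_continuous. polyt.
Qed.

Lemma SP_unif n F dF a eps :
  -1 < a < 1 -> SP n F dF -> 0 < eps ->
  locally a (fun b => forall x, -1 <= x <= 1 -> Rabs (F b x - F a x) < eps).
Proof.
  intros Ha; revert F dF eps; induction n as [|n IH]; intros F dF eps HF Heps.
  - generalize (locally_unit a Ha). apply filter_imp. intros b Hb x _.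
    destruct (HF b Hb x) as (-> & _). destruct (HF a Ha x) as (-> & _).
    rewrite Rminus_0_r, Rabs_R0. exact Heps.
  - destruct HF as (c & dc & G & dG & Hc & HG & E).
    assert (H2 : 0 < eps / 2) by lra.
    assert (HG' := IH G dG (eps / 2) HG H2).
    assert (Hc' : locally a (fun b => Rabs (c b - c a) < eps / 2)).
    { assert (Hcc : continuous c a)
        by (apply (ex_derive_continuous c); exists (dc a); now apply Hc).
      apply (Hcc (fun y => Rabs (y - c a) < eps / 2)).
      now exists (mkposreal _ H2). }
    generalize (filter_and _ _ (filter_and _ _ HG' Hc') (locally_unit a Ha)).
    apply filter_imp. intros b ((H3 & H4) & Hb) x Hx.
    destruct (E b Hb x) as (-> & _). destruct (E a Ha x) as (-> & _).
    replace (c b * x ^ n + G b x - (c a * x ^ n + G a x))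
      with ((c b - c a) * x ^ n + (G b x - G a x)) by ring.
    eapply Rle_lt_trans; [apply Rabs_triang|].
    rewrite Rabs_mult, <- RPow_abs.
    assert (Hx1 : Rabs x ^ n <= 1).
    { rewrite <- (pow1 n). apply pow_incr. split; [apply Rabs_pos|].
      apply Rabs_le. lra. }
    assert (Hx0 : 0 <= Rabs x ^ n) by (apply pow_le, Rabs_pos).
    assert (H5 := H3 x Hx). assert (H6 := Rabs_pos (c b - c a)). nra.
Qed.

(** * Orthogonal polynomials *)

Definition Orth (p : nat) (a : R) (k : nat) (f : R -> R) : Prop :=
  monic k f /\ forall r, Pd k r -> L p a (fun x => f x * r x) = 0.

Lemma Orth_monic p a k f : Orth p a k f -> monic k f.
Proof. now intros (H & _). Qed.

Lemma Orth_poly p a k f : Orth p a k f -> poly f.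
Proof. intros (H & _). exact (Pd_poly _ _ (monic_Pd _ _ H)). Qed.

Lemma Orth_norm_pos p a k f : -1 < a < 1 -> Orth p a k f -> 0 < L p a (fun x => f x * f x).
Proof.
  intros Ha Hf. apply L_sqr_pos; [assumption|now apply (Orth_poly p a k)|].
  now apply (monic_nonzero k), (Orth_monic p a).
Qed.

Lemma Orth_monic_product p a k f r :
  -1 < a < 1 -> Orth p a k f -> monic k r ->
  L p a (fun x => f x * r x) = L p a (fun x => f x * f x).
Proof.
  intros Ha (Hm & Ho) Hr.
  assert (Hd : Pd k (fun x => r x - f x)).
  { apply Pd_ext with (fun x => (r x - x ^ k) - (f x - x ^ k)); [intros; ring|].
    now apply Pd_minus. }
  assert (Hfp := Pd_poly _ _ (monic_Pd _ _ Hm)).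
  rewrite (L_ext p a _ (fun x => f x * (r x - f x) + f x * f x)) by (intros; ring).
  rewrite L_plus, Ho; try assumption; [ring| |]; polyt.
Qed.

Lemma Orth_unique p a k f g :
  -1 < a < 1 -> Orth p a k f -> Orth p a k g -> forall x, f x = g x.
Proof.
  intros Ha Hf Hg.
  assert (Hd : Pd k (fun x => f x - g x)).
  { apply Pd_ext with (fun x => (f x - x ^ k) - (g x - x ^ k)); [intros; ring|].
    apply Pd_minus; [apply Hf|apply Hg]. }
  destruct (classic (exists x, f x - g x <> 0)) as [Hn|Hn].
  - exfalso. assert (Hfp := Orth_poly _ _ _ _ Hf). assert (Hgp := Orth_poly _ _ _ _ Hg).
    assert (H := L_sqr_pos p a _ Ha (Pd_poly _ _ Hd) Hn). simpl in H.
    rewrite (L_ext p a _ (fun x => f x * (f x - g x) - g x * (f x - g x))) in H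
      by (intros; ring).
    rewrite L_minus in H; try assumption; try polyt.
    rewrite (proj2 Hf _ Hd), (proj2 Hg _ Hd) in H. lra.
  - intros x. apply NNPP. intros Hx. apply Hn. exists x. lra.
Qed.

Lemma Pd_split k r f :
  Pd (S k) r -> monic k f ->
  exists c s, Pd k s /\ forall x, r x = c * f x + s x.
Proof.
  intros (c & g & Hg & E) Hf. exists c, (fun x => g x - c * (f x - x ^ k)).
  split; [now apply Pd_minus; [|apply Pd_scal]|]. intros x. rewrite E. ring.
Qed.

Lemma Orth_0 p a f : (forall x, f x = 1) -> Orth p a 0 f.
Proof.
  intros Hf. split; [intros x; rewrite Hf; simpl; ring|].
  intros r Hr. rewrite (L_ext p a _ (fun _ => 0)); [apply L_zero|].
  intros x _. simpl in Hr. rewrite Hr. ring.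
Qed.

Lemma Orth_1 p a :
  -1 < a < 1 ->
  Orth p a 1 (fun x => x - L p a (fun x => x) / L p a (fun _ => 1)).
Proof.
  intros Ha.
  assert (HK : 0 < L p a (fun _ => 1)).
  { apply L_pos; [assumption|polyt|intros; lra|exists 0; lra]. }
  split.
  - apply Pd_ext with (fun x => - (L p a (fun x => x) / L p a (fun _ => 1)));
      [intros; simpl; ring|apply Pd_const].
  - intros r (c & g & Hg & E). simpl in Hg.
    rewrite (L_ext p a _
      (fun x => c * (x - L p a (fun x => x) / L p a (fun _ => 1) * 1)))
      by (intros; rewrite E, Hg; simpl; ring).
    rewrite L_scal, L_minus, L_scal; try assumption; try polyt. field. lra.
Qed.

(** The two coefficients are exactly those that enforce orthogonality to [f1] and to [f0].
    Polynomials [r2] of degree [< k] impose no condition, since [x * r2] still has degree below that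
    of [f1]. *)
Lemma Orth_recurrence p a k f0 f1 :
  -1 < a < 1 -> Orth p a k f0 -> Orth p a (S k) f1 ->
  Orth p a (S (S k))
    (fun x => x * f1 x
      - L p a (fun x => x * (f1 x * f1 x)) / L p a (fun x => f1 x * f1 x) * f1 x
      - L p a (fun x => f1 x * f1 x) / L p a (fun x => f0 x * f0 x) * f0 x).
Proof.
  intros Ha H0 H1.
  assert (Hn0 := Orth_norm_pos _ _ _ _ Ha H0). assert (Hn1 := Orth_norm_pos _ _ _ _ Ha H1).
  assert (Hp0 := Orth_poly _ _ _ _ H0). assert (Hp1 := Orth_poly _ _ _ _ H1).
  assert (Hd0 := monic_Pd _ _ (Orth_monic _ _ _ _ H0)).
  assert (Hd1 := monic_Pd _ _ (Orth_monic _ _ _ _ H1)).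
  set (n0 := L p a (fun x => f0 x * f0 x)) in *.
  set (n1 := L p a (fun x => f1 x * f1 x)) in *.
  set (s := L p a (fun x => x * (f1 x * f1 x))).
  set (A := s / n1). set (B := n1 / n0).
  split.
  - apply Pd_ext with (fun x => ((x - 0) * f1 x - x ^ S (S k)) - (A * f1 x + B * f0 x));
      [intros; ring|].
    apply Pd_minus; [exact (monic_mul_linear _ _ 0 (Orth_monic _ _ _ _ H1))|].
    apply Pd_plus; apply Pd_scal; [exact Hd1|now apply Pd_S].
  - intros r Hr.
    destruct (Pd_split _ r f1 Hr (Orth_monic _ _ _ _ H1)) as (c & r1 & Hr1 & E1).
    destruct (Pd_split _ r1 f0 Hr1 (Orth_monic _ _ _ _ H0)) as (d & r2 & Hr2 & E2).
    assert (HL : forall h, poly h ->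
      L p a (fun x => (x * f1 x - A * f1 x - B * f0 x) * h x)
      = L p a (fun x => f1 x * (x * h x)) - A * L p a (fun x => f1 x * h x)
        - B * L p a (fun x => f0 x * h x)).
    { intros h Hh.
      rewrite (L_ext p a _ (fun x => f1 x * (x * h x) - A * (f1 x * h x) - B * (f0 x * h x)))
        by (intros; ring).
      rewrite !L_minus, !L_scal; try assumption; try polyt. reflexivity. }
    rewrite (L_ext p a _ (fun x =>
      c * ((x * f1 x - A * f1 x - B * f0 x) * f1 x)
      + (d * ((x * f1 x - A * f1 x - B * f0 x) * f0 x)
         + (x * f1 x - A * f1 x - B * f0 x) * r2 x)))
      by (intros; rewrite E1, E2; ring).
    rewrite !L_plus, !L_scal; try assumption; try polyt.
    rewrite !HL; try assumption; try polyt.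
    assert (H10 : L p a (fun x => f1 x * f0 x) = 0) by (now apply (proj2 H1)).
    assert (H01 : L p a (fun x => f0 x * f1 x) = 0).
    { rewrite <- H10. apply L_ext. intros; ring. }
    (* [x * f0] is monic of the same degree as [f1]; this is the origin of the numerator [n1] in
       [B]. *)
    assert (Hx0 : L p a (fun x => f1 x * (x * f0 x)) = n1).
    { apply (Orth_monic_product p a (S k) f1); try assumption.
      apply monic_ext with (fun x => (x - 0) * f0 x); [intros; ring|].
      exact (monic_mul_linear _ _ 0 (Orth_monic _ _ _ _ H0)). }
    assert (Hx1 : L p a (fun x => f1 x * (x * f1 x)) = s).
    { apply L_ext. intros; ring. }
    rewrite H10, H01, Hx0, Hx1. fold n0 n1.
    rewrite (proj2 H1 (fun x => x * r2 x)) by now apply Pd_mulx.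
    rewrite (proj2 H1 r2) by now apply Pd_S.
    rewrite (proj2 H0 r2) by assumption.
    unfold A, B. field. lra.
Qed.

(** Subtracting the constant leading term records that [dF b] has degree [< k]. In the Markov
    argument this is the bound that lets the integral of [dF * q] be replaced by a value at the
    zero. *)
Definition SPM (k : nat) (F dF : R -> R -> R) : Prop :=
  SP k (fun b x => F b x - x ^ k) dF.

Lemma SPM_SP k F dF : SPM k F dF -> SP (S k) F dF.
Proof.
  intros H. exists (fun _ => 1), (fun _ => 0), (fun b x => F b x - x ^ k), dF.
  split; [|split; [exact H|intros; split; ring]].
  intros b _. apply (is_derive_const (K := R_AbsRing) (V := R_NormedModule)).
Qed.

Lemma SP_L_ex_derive p n F dF b :
  -1 < b < 1 -> SP n F dF -> ex_derive (fun b => L p b (F b)) b.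
Proof. intros Hb HF. eexists. now apply (SP_L_derive p n F dF b). Qed.

(** The recurrence has depth two, so two consecutive families are carried along. Its coefficients
    are quotients of integrals of earlier members, differentiable by [SP_L_derive], with positive
    norms as denominators. *)
Lemma Orth_family_pair p k :
  exists F dF F' dF', SPM k F dF /\ SPM (S k) F' dF' /\
    (forall b, -1 < b < 1 -> Orth p b k (F b) /\ Orth p b (S k) (F' b)).
Proof.
  induction k as [|k (F & dF & F' & dF' & HF & HF' & HO)].
  - set (A := fun b => L p b (fun x => x) / L p b (fun _ => 1)).
    exists (fun _ _ => 1), (fun _ _ => 0), (fun b x => x - A b), (fun b _ => - Derive A b).
    split; [intros b Hb x; simpl; split; ring|]. split.
    + exists (fun b => - A b), (fun b => - Derive A b), (fun _ _ => 0), (fun _ _ => 0).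
      split; [|split; [apply SP_zero|intros; simpl; split; ring]].
      intros b Hb. apply (is_derive_opp A). apply Derive_correct.
      apply ex_derive_div.
      * apply (SP_L_ex_derive p 2 (fun _ x => x) (fun _ _ => 0)); [assumption|].
        generalize (SP_pow 1). apply SP_ext; intros; simpl; ring.
      * apply (SP_L_ex_derive p 1 (fun _ _ => 1) (fun _ _ => 0)); [assumption|].
        generalize (SP_pow 0). apply SP_ext; intros; simpl; ring.
      * apply Rgt_not_eq. apply L_pos; [assumption|polyt|intros; lra|exists 0; lra].
    + intros b Hb. split; [now apply Orth_0|]. now apply Orth_1.
  - set (A := fun b => L p b (fun x => x * (F' b x * F' b x)) / L p b (fun x => F' b x * F' b x)).
    set (B := fun b => L p b (fun x => F' b x * F' b x) / L p b (fun x => F b x * F b x)).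
    set (G := fun b x => x * F' b x - A b * F' b x - B b * F b x).
    assert (SF := SPM_SP _ _ _ HF). assert (SF' := SPM_SP _ _ _ HF').
    assert (SFF := SP_mult _ _ _ _ _ _ SF SF).
    assert (SFF' := SP_mult _ _ _ _ _ _ SF' SF').
    assert (SxFF' := SP_mulx _ _ _ SFF').
    assert (HA : forall b, -1 < b < 1 -> is_derive A b (Derive A b)).
    { intros b Hb. destruct (HO b Hb) as (H0 & H1). apply Derive_correct, ex_derive_div.
      - exact (SP_L_ex_derive p _ _ _ b Hb SxFF').
      - exact (SP_L_ex_derive p _ _ _ b Hb SFF').
      - apply Rgt_not_eq. exact (Orth_norm_pos _ _ _ _ Hb H1). }
    assert (HB : forall b, -1 < b < 1 -> is_derive B b (Derive B b)).
    { intros b Hb. destruct (HO b Hb) as (H0 & H1). apply Derive_correct, ex_derive_div.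
      - exact (SP_L_ex_derive p _ _ _ b Hb SFF').
      - exact (SP_L_ex_derive p _ _ _ b Hb SFF).
      - apply Rgt_not_eq. exact (Orth_norm_pos _ _ _ _ Hb H0). }
    assert (S1 := SP_scal_const _ (-1) _ _ (SP_scal _ _ _ _ _ HA SF')).
    assert (S2 := SP_scal_const _ (-1) _ _ (SP_S _ _ _ (SP_scal _ _ _ _ _ HB SF))).
    assert (S3 := SP_plus _ _ _ _ _ (SP_mulx _ _ _ HF') (SP_plus _ _ _ _ _ S1 S2)).
    exists F', dF', G. eexists. split; [exact HF'|]. split.
    + refine (SP_ext _ _ _ _ _ _ (fun b x _ => eq_refl) S3).
      intros b x _. unfold G. simpl. ring.
    + intros b Hb. destruct (HO b Hb) as (H0 & H1). split; [exact H1|].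
      now apply Orth_recurrence.
Qed.

Lemma Orth_family p k :
  exists F dF, SPM k F dF /\ (forall b, -1 < b < 1 -> Orth p b k (F b)).
Proof.
  destruct (Orth_family_pair p k) as (F & dF & F' & dF' & HF & _ & HO).
  exists F, dF. split; [exact HF|]. intros b Hb. now apply HO.
Qed.

Lemma Pd_coef k f :
  Pd (S k) f <-> exists c, forall x, f x = sum_f_R0 (fun i => c i * x ^ i) k.
Proof.
  split.
  - revert f; induction k as [|k IH]; intros f (c & g & Hg & E).
    + exists (fun _ => c). intros x. simpl in Hg. rewrite E, Hg. simpl. ring.
    + destruct (IH g Hg) as (d & Ed).
      exists (fun i => if Nat.eqb i (S k) then c else d i). intros x.
      rewrite tech5, Nat.eqb_refl, E, Ed, Rplus_comm. f_equal.
      apply sum_eq. intros i Hi. destruct (Nat.eqb_spec i (S k)); [lia|reflexivity].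
  - intros (c & E). apply Pd_ext with (fun x => sum_f_R0 (fun i => c i * x ^ i) k); [easy|].
    apply Pd_sum. intros i Hi. apply Pd_le with (S i); [lia|apply Pd_pow].
Qed.

Lemma monic_coef k f :
  monic k f <-> exists c, c k = 1 /\ forall x, f x = sum_f_R0 (fun i => c i * x ^ i) k.
Proof.
  destruct k as [|k].
  - split.
    + intros H. exists (fun _ => 1). split; [reflexivity|].
      intros x. specialize (H x). simpl in *. lra.
    + intros (c & Hc & E) x. rewrite E. simpl. rewrite Hc. ring.
  - unfold monic. rewrite Pd_coef. split.
    + intros (c & E). exists (fun i => if Nat.eqb i (S k) then 1 else c i).
      rewrite Nat.eqb_refl. split; [reflexivity|]. intros x.
      rewrite tech5, Nat.eqb_refl.
      rewrite (sum_eq _ (fun i => c i * x ^ i)).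
      * rewrite <- E. ring.
      * intros i Hi. destruct (Nat.eqb_spec i (S k)); [lia|reflexivity].
    + intros (c & Hc & E). exists c. intros x. rewrite E, tech5, Hc. ring.
Qed.

Lemma is_monic_orth_Orth p a k f :
  -1 < a < 1 -> is_monic_orth p a k f <-> Orth p a k f.
Proof.
  intros Ha. unfold is_monic_orth. rewrite <- monic_coef. split.
  - intros (Hm & Ho). split; [exact Hm|].
    assert (Hp := Pd_poly _ _ (monic_Pd _ _ Hm)).
    assert (H : forall m, (m <= k)%nat -> forall r, Pd m r -> L p a (fun x => f x * r x) = 0).
    { induction m as [|m IH]; intros Hmk r Hr.
      - rewrite (L_ext p a _ (fun _ => 0)); [apply L_zero|].
        intros x _. simpl in Hr. rewrite Hr. ring.
      - destruct Hr as (c & g & Hg & E).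
        rewrite (L_ext p a _ (fun x => c * (x ^ m * f x) + f x * g x))
          by (intros; rewrite E; ring).
        rewrite L_plus, L_scal, (IH ltac:(lia) g Hg); try assumption; try polyt.
        rewrite <- (Int_L p a (fun x => x ^ m * f x)
          (fun mu => mu ^ m * f mu * weight p a mu)); try assumption;
          [|polyt|reflexivity].
        rewrite Ho by lia. ring. }
    intros r Hr. now apply (H k).
  - intros (Hm & Ho). split; [exact Hm|]. intros j Hj.
    assert (Hp := Pd_poly _ _ (monic_Pd _ _ Hm)).
    rewrite (Int_L p a (fun x => f x * x ^ j)); try assumption; [|polyt|intros; ring].
    apply Ho. apply Pd_le with (S j); [lia|apply Pd_pow].
Qed.

Lemma phi_Orth p a k : -1 < a < 1 -> Orth p a k (phi p a k).
Proof.
  intros Ha. apply is_monic_orth_Orth; [assumption|]. unfold phi. apply epsilon_spec.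
  destruct (Orth_family p k) as (F & dF & _ & HO). exists (F a).
  apply is_monic_orth_Orth; [assumption|]. now apply HO.
Qed.

Lemma Kint_L p a j k :
  -1 < a < 1 -> Kint p a j k = L p a (fun x => x ^ j * phi p a k x).
Proof.
  intros Ha. assert (H := Orth_poly _ _ _ _ (phi_Orth p a k Ha)).
  unfold Kint. apply Int_L; [assumption|polyt|reflexivity].
Qed.

Lemma Kint_norm p a k :
  -1 < a < 1 -> Kint p a k k = L p a (fun x => phi p a k x * phi p a k x).
Proof.
  intros Ha. rewrite Kint_L by assumption. assert (H := phi_Orth p a k Ha).
  rewrite <- (Orth_monic_product p a k _ (fun x => x ^ k) Ha H).
  - apply L_ext. intros; ring.
  - unfold monic. apply Pd_ext with (fun _ => 0); [intros; ring|apply Pd_zero].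
Qed.

Lemma Kint_pos p a k : -1 < a < 1 -> 0 < Kint p a k k.
Proof.
  intros Ha. rewrite Kint_norm by assumption.
  apply Orth_norm_pos with k; [assumption|]. now apply phi_Orth.
Qed.

(** * Zeros and Gauss quadrature *)

Lemma monic_mul_prodroots n f l :
  monic n f -> monic (length l + n) (fun x => prodroots l x * f x).
Proof.
  intros Hf; induction l as [|z l IH]; simpl.
  - apply monic_ext with f; [intros; ring|exact Hf].
  - apply monic_ext with (fun x => (x - z) * (prodroots l x * f x)); [intros; ring|].
    now apply monic_mul_linear.
Qed.

(** With fewer than [n] sign changes in (-1,1), their [prodroots] would be a test polynomial of
    lower degree, yet its product with [f] has constant sign and is not identically zero. *)
Lemma Orth_roots p a n f :
  -1 < a < 1 -> Orth p a n f ->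
  exists l, NoDup l /\ length l = n /\ (forall y, In y l -> -1 < y < 1) /\
    forall x, f x = prodroots l x.
Proof.
  intros Ha (Hm & Ho).
  assert (Hf := Pd_poly _ _ (monic_Pd _ _ Hm)).
  destruct (Pd_sign_changes (S n) f (monic_Pd _ _ Hm)) as (l & Hl & Hr & Hs).
  assert (Hle : (length l <= n)%nat)
    by (apply (monic_roots_length n f l Hm Hl); intros y Hy; now apply Hr).
  assert (Hlen : length l = n).
  { destruct (Nat.lt_ge_cases (length l) n) as [Hlt|Hge]; [exfalso|lia].
    assert (HP := monic_Pd _ _ (prodroots_monic l)).
    assert (H0 : L p a (fun x => f x * prodroots l x) = 0)
      by (apply Ho; apply Pd_le with (2 := HP); lia).
    destruct (monic_nonzero _ _ (monic_mul_prodroots n f l Hm)) as (x0 & Hx0).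
    destruct Hs as [Hs|Hs].
    - enough (0 < L p a (fun x => f x * prodroots l x)) by lra.
      apply L_pos; [assumption|polyt|exact Hs|]. exists x0. now rewrite Rmult_comm.
    - enough (0 < L p a (fun x => (-1) * (f x * prodroots l x)))
        by (rewrite L_scal in H; [lra|assumption|polyt]).
      apply L_pos; [assumption|polyt| |].
      + intros x Hx. specialize (Hs x Hx). lra.
      + exists x0. lra. }
  exists l. split; [exact Hl|]. split; [exact Hlen|]. split.
  - intros y Hy. now apply Hr.
  - apply (monic_prodroots n f l Hm Hl Hlen). intros y Hy. now apply Hr.
Qed.

Section Quotient.
Variables (p m : nat) (a z : R) (f q : R -> R).
Hypothesis Ha : -1 < a < 1.
Hypothesis Hf : Orth p a (S m) f.
Hypothesis Hq : monic m q.
Hypothesis Hfq : forall x, f x = (x - z) * q x.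

(** [(g - g z) q] equals [f s] with [s] of degree [< m], and [f] annihilates [s]. Thus [q] is, up to
    scale, the reproducing kernel at [z] for degree [<= m]. *)
Lemma quotient_eval g : Pd (S m) g -> L p a (fun x => g x * q x) = g z * L p a q.
Proof.
  intros Hg. destruct (Pd_factor m g z Hg) as (s & Hs & E).
  assert (Hqp := Pd_poly _ _ (monic_Pd _ _ Hq)).
  assert (Hfp := Orth_poly _ _ _ _ Hf).
  rewrite (L_ext p a _ (fun x => g z * q x + f x * s x))
    by (intros x _; rewrite (E x), Hfq; ring).
  rewrite L_plus, L_scal, (proj2 Hf s); try assumption; try polyt; [ring|].
  now apply Pd_S.
Qed.

(** The choice [g = q] produces the integral of [q * q]. The inequality yields both that the zero
    [z] is simple and that [L p a q] is nonzero. *)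
Lemma quotient_eval_pos : 0 < q z * L p a q.
Proof.
  rewrite <- quotient_eval by now apply monic_Pd.
  apply L_sqr_pos; [assumption| |now apply (monic_nonzero m)].
  exact (Pd_poly _ _ (monic_Pd _ _ Hq)).
Qed.

End Quotient.

(** * Gauss quadrature with positive masses *)

Lemma prodroots_remove l y x :
  NoDup l -> In y l -> prodroots l x = (x - y) * prodroots (remove Req_dec_T y l) x.
Proof.
  induction l as [|z l IH]; intros Hl Hy; [easy|].
  inversion_clear Hl as [|? ? Hz Hl']. simpl. destruct (Req_dec_T y z) as [->|Hne].
  - now rewrite notin_remove.
  - destruct Hy as [->|Hy]; [easy|]. simpl. rewrite IH by assumption. ring.
Qed.

Definition lsum (l : list R) (h : R -> R) : R := fold_right (fun y s => h y + s) 0 l.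

Lemma lsum_ext l h h' : (forall y, In y l -> h y = h' y) -> lsum l h = lsum l h'.
Proof.
  induction l as [|z l IH]; simpl; intros E; [reflexivity|].
  rewrite E, IH; auto.
Qed.

Lemma lsum_zero l h : (forall y, In y l -> h y = 0) -> lsum l h = 0.
Proof.
  induction l as [|z l IH]; simpl; intros E; [reflexivity|].
  rewrite E, IH; auto. ring.
Qed.

Lemma lsum_single l h z :
  NoDup l -> In z l -> (forall y, In y l -> y <> z -> h y = 0) -> lsum l h = h z.
Proof.
  induction l as [|y l IH]; simpl; intros Hl Hz E; [easy|].
  inversion_clear Hl as [|? ? Hy Hl']. destruct (Req_dec y z) as [<-|Hne].
  - rewrite lsum_zero; [ring|]. intros t Ht. apply E; [now right|].
    intros ->; now apply Hy.
  - destruct Hz as [?|Hz]; [easy|]. rewrite (E y), IH; auto. ring.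
Qed.

Lemma lsum_neg l h z :
  (forall y, In y l -> h y <= 0) -> In z l -> h z < 0 -> lsum l h < 0.
Proof.
  assert (Hle : forall l, (forall y, In y l -> h y <= 0) -> lsum l h <= 0).
  { clear l. induction l as [|y l IH]; simpl; intros H; [lra|].
    assert (H1 := H y (or_introl eq_refl)).
    assert (lsum l h <= 0) by (apply IH; auto). lra. }
  induction l as [|y l IH]; simpl; intros H Hz Hhz; [easy|].
  destruct Hz as [->|Hz].
  - assert (lsum l h <= 0) by (apply Hle; auto). lra.
  - assert (H1 := H y (or_introl eq_refl)). assert (lsum l h < 0) by (apply IH; auto). lra.
Qed.

Lemma Pd_lsum n l (c : R -> R) (Q : R -> R -> R) :
  (forall y, In y l -> Pd n (Q y)) -> Pd n (fun x => lsum l (fun y => c y * Q y x)).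
Proof.
  induction l as [|z l IH]; simpl; intros H; [apply Pd_zero|].
  apply Pd_plus; [apply Pd_scal, H; now left|apply IH; auto].
Qed.

Lemma L_lsum p a l (c : R -> R) (Q : R -> R -> R) :
  -1 < a < 1 -> (forall y, In y l -> poly (Q y)) ->
  L p a (fun x => lsum l (fun y => c y * Q y x)) = lsum l (fun y => c y * L p a (Q y)).
Proof.
  intros Ha.
  enough (H : (forall y, In y l -> poly (Q y)) ->
    poly (fun x => lsum l (fun y => c y * Q y x)) /\
    L p a (fun x => lsum l (fun y => c y * Q y x)) = lsum l (fun y => c y * L p a (Q y)))
    by apply H.
  induction l as [|z l IH]; simpl; intros HQ; [split; [polyt|apply L_zero]|].
  destruct IH as (IH1 & IH2); [auto|]. assert (Hz := HQ z (or_introl eq_refl)).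
  split; [polyt|]. rewrite L_plus, L_scal, IH2; try assumption; [reflexivity|polyt].
Qed.

(** Modulo [f], which has integral 0 and vanishes at the nodes, [g] is its own Lagrange interpolant,
    so the masses are the integrals of the Lagrange basis; [quotient_eval_pos] makes them positive.
    Exactness up to degree [n] covers the quadratic integrand used below, where [n >= 2]. *)
Lemma Gauss_quadrature p a n f l :
  -1 < a < 1 -> Orth p a n f -> NoDup l -> length l = n -> (1 <= n)%nat ->
  (forall x, f x = prodroots l x) ->
  exists W, (forall y, In y l -> 0 < W y) /\
    forall g, Pd (S n) g -> L p a g = lsum l (fun y => W y * g y).
Proof.
  intros Ha Hf Hl Hlen Hn E. destruct n as [|m]; [lia|].
  set (Q := fun y => prodroots (remove Req_dec_T y l)).
  assert (EQ : forall y, In y l -> forall x, f x = (x - y) * Q y x)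
    by (intros y Hy x; rewrite E; now apply prodroots_remove).
  assert (HQ : forall y, In y l -> monic m (Q y)).
  { intros y Hy. replace m with (length (remove Req_dec_T y l)); [apply prodroots_monic|].
    apply Nat.succ_inj. rewrite <- Hlen.
    apply in_split in Hy. destruct Hy as (l1 & l2 & El).
    rewrite El in *. apply NoDup_remove_2 in Hl. rewrite in_app_iff in Hl.
    rewrite remove_app, remove_cons, !notin_remove by tauto.
    rewrite !length_app. simpl. lia. }
  assert (HQy : forall y, In y l -> 0 < Q y y * L p a (Q y)).
  { intros y Hy. now apply (quotient_eval_pos p m a y f (Q y) Ha Hf (HQ y Hy) (EQ y Hy)). }
  exists (fun y => L p a (Q y) / Q y y). split.
  - intros y Hy. assert (H := HQy y Hy). assert (Q y y <> 0) by (intros H0; rewrite H0 in H; lra).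
    replace (L p a (Q y) / Q y y) with (Q y y * L p a (Q y) * / (Q y y * Q y y)) by (field; assumption).
    apply Rmult_lt_0_compat; [exact H|]. apply Rinv_0_lt_compat. nra.
  - intros g Hg. destruct (Pd_split (S m) g f Hg (Orth_monic _ _ _ _ Hf)) as (c & r & Hr & Eg).
    assert (Hfp := Orth_poly _ _ _ _ Hf).
    (* Lagrange interpolation: the difference has degree [<= m] and vanishes at the [S m] nodes. *)
    assert (EL : forall x, r x - lsum l (fun y => r y / Q y y * Q y x) = 0).
    { apply (Pd_roots_zero (S m) _ l); [|assumption|lia|].
      - apply Pd_minus; [exact Hr|]. apply Pd_lsum. intros y Hy. now apply monic_Pd, HQ.
      - intros z Hz. rewrite (lsum_single l _ z Hl Hz).
        + assert (H := HQy z Hz). field. intros H0; rewrite H0 in H; lra.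
        + intros y Hy Hne. assert (H1 := EQ y Hy z). rewrite E in H1.
          rewrite (proj2 (prodroots_root l z) Hz) in H1. symmetry in H1.
          apply Rmult_integral in H1. destruct H1 as [H1|H1]; [lra|]. rewrite H1. ring. }
    rewrite (L_ext p a g (fun x => c * (f x * 1) + lsum l (fun y => r y / Q y y * Q y x))).
    2:{ intros x _. rewrite Eg. specialize (EL x). lra. }
    rewrite L_plus, L_scal, (proj2 Hf (fun _ => 1)), L_lsum; try assumption; try polyt.
    + rewrite Rmult_0_r, Rplus_0_l. apply lsum_ext. intros y Hy.
      rewrite (Eg y). replace (f y) with 0 by (symmetry; rewrite E; now apply prodroots_root).
      assert (H := HQy y Hy). field. intros H0; rewrite H0 in H; lra.
    + intros y Hy. exact (Pd_poly _ _ (monic_Pd _ _ (HQ y Hy))).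
    + apply Pd_le with 1%nat; [lia|apply Pd_const].
    + apply Pd_poly with (S m). apply Pd_lsum. intros y Hy. now apply monic_Pd, HQ.
Qed.

(* The mean of the weight [p - 1] lies strictly inside the convex hull of the
   Gauss nodes of the weight [p]. *)
Lemma extreme_root_not_mean p a n f z s :
  -1 < a < 1 -> Orth p a n f -> (2 <= n)%nat -> f z = 0 -> s * s = 1 ->
  (forall y, f y = 0 -> s * y <= s * z) ->
  L p a (fun x => (x - z) * (1 + a * x)) <> 0.
Proof.
  intros Ha Hf Hn Hz Hs Hext.
  destruct (Orth_roots p a n f Ha Hf) as (l & Hl & Hlen & Hin & E).
  destruct (Gauss_quadrature p a n f l Ha Hf Hl Hlen ltac:(lia) E) as (W & HW & HG).
  assert (Hroot : forall y, In y l <-> f y = 0).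
  { intros y. rewrite E. symmetry. apply prodroots_root. }
  assert (Hz' := proj2 (Hroot z) Hz).
  rewrite HG.
  2:{ apply Pd_le with 3%nat; [lia|].
      exists a, (fun x => (1 - z * a) * x ^ 1 + (- z)). split.
      - exists (1 - z * a), (fun _ => - z). split; [apply Pd_const|]. intros; ring.
      - intros; simpl; ring. }
  assert (Hother : exists y, In y l /\ y <> z).
  { destruct l as [|y1 [|y2 l]]; simpl in Hlen; try lia.
    destruct (Req_dec y1 z) as [->|Hne]; [|exists y1; split; [now left|assumption]].
    exists y2. split; [right; now left|]. intros ->. inversion_clear Hl. apply H. now left. }
  destruct Hother as (y0 & Hy0 & Hne).
  (* As [z] is extreme, every term multiplied by [s] is [<= 0], strictly so at the second node
     [y0]. *)
  assert (Hneg : lsum l (fun y => s * (W y * ((y - z) * (1 + a * y)))) < 0).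
  { apply lsum_neg with y0; [|exact Hy0|].
    - intros y Hy. assert (H1 := HW y Hy).
      assert (H2 := one_plus_pos a y Ha ltac:(destruct (Hin y Hy); lra)).
      assert (H3 := Hext y (proj1 (Hroot y) Hy)).
      replace (s * (W y * ((y - z) * (1 + a * y))))
        with (- (W y * (1 + a * y) * (s * z - s * y))) by ring.
      assert (0 <= W y * (1 + a * y) * (s * z - s * y)); [|lra].
      apply Rmult_le_pos; [|lra]. apply Rmult_le_pos; lra.
    - assert (H1 := HW y0 Hy0).
      assert (H2 := one_plus_pos a y0 Ha ltac:(destruct (Hin y0 Hy0); lra)).
      assert (H3 := Hext y0 (proj1 (Hroot y0) Hy0)).
      replace (s * (W y0 * ((y0 - z) * (1 + a * y0))))
        with (- (W y0 * (1 + a * y0) * (s * z - s * y0))) by ring.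
      assert (0 < W y0 * (1 + a * y0) * (s * z - s * y0)); [|lra].
      apply Rmult_lt_0_compat; [apply Rmult_lt_0_compat; assumption|].
      assert (s * y0 <> s * z); [|lra]. intros H4. apply Hne.
      apply Rmult_eq_reg_l with s; [exact H4|]. intros H5; rewrite H5 in Hs; lra. }
  intros H0.
  assert (Hscal : forall (h : R -> R) l, lsum l (fun y => s * h y) = s * lsum l h).
  { intros h l'; induction l' as [|y l' IH]; simpl; [ring|]. rewrite IH. ring. }
  rewrite Hscal, H0 in Hneg. lra.
Qed.

(* Markov's theorem on the motion of zeros: differentiate the orthogonality
   relation [L p b (F b * q) = 0] with [q = F a / (x - z)] frozen at [b = a]. *)
Lemma Markov_derivative_nonzero p n F dF a z :
  (0 < p)%nat -> -1 < a < 1 -> -1 < z < 1 ->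
  SPM (S n) F dF -> (forall b, -1 < b < 1 -> Orth p b (S n) (F b)) ->
  F a z = 0 -> dF a z <> 0.
Proof.
  intros Hp Ha Hz HF HO Hroot.
  assert (Hfa := HO a Ha). assert (Hfp := Orth_poly _ _ _ _ Hfa).
  destruct (monic_factor n (F a) z (Orth_monic _ _ _ _ Hfa) Hroot) as (q & Hq & E).
  assert (Hqd := monic_Pd _ _ Hq). assert (Hqp := Pd_poly _ _ Hqd).
  destruct (SP_Pd _ _ _ a Ha HF) as (_ & HdF).
  assert (HFq := SP_mult _ _ _ _ _ _ (SPM_SP _ _ _ HF) (SP_fixed _ q Hqd)).
  assert (HD := SP_L_derive p _ _ _ a Ha HFq). simpl in HD.
  assert (H0 : is_derive (fun b => L p b (fun x => F b x * q x)) a 0).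
  { apply is_derive_ext_loc with (fun _ => 0).
    - generalize (locally_unit a Ha). apply filter_imp. intros b Hb.
      symmetry. apply (proj2 (HO b Hb)). exact Hqd.
    - apply (is_derive_const (K := R_AbsRing) (V := R_NormedModule)). }
  apply is_derive_unique in HD. apply is_derive_unique in H0.
  assert (HD' := eq_trans (eq_sym H0) HD). clear H0 HD. rename HD' into HD.
  rewrite (L_ext p a _ (fun x => dF a x * q x)) in HD by (intros; ring).
  rewrite (quotient_eval p n a z (F a) q Ha Hfa Hq E _ HdF) in HD.
  assert (Hpos : 0 < L (S p) a (fun x => F a x * F a x)).
  { apply L_sqr_pos; try assumption. exact (monic_nonzero _ _ (Orth_monic _ _ _ _ Hfa)). }
  assert (Horth : L (S p) a (fun x => (1 + a * x) * (F a x * q x)) = 0).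
  { rewrite <- L_weight_S by assumption. now apply (proj2 Hfa). }
  (* The identity [x - z = (1 + a z) x - z (1 + a x)], multiplied by [F a * q], isolates the
     vanishing integral [Horth]. *)
  assert (Hkey : (1 + a * z) * L (S p) a (fun x => x * (F a x * q x))
                 = L (S p) a (fun x => F a x * F a x)).
  { rewrite (L_ext (S p) a (fun x => F a x * F a x)
      (fun x => (1 + a * z) * (x * (F a x * q x)) - z * ((1 + a * x) * (F a x * q x))))
      by (intros x _; rewrite E; ring).
    rewrite L_minus, !L_scal, Horth; try assumption; try polyt. ring. }
  assert (Hp' : 0 < INR p) by now apply lt_0_INR.
  intros HdF0. rewrite HdF0 in HD.
  assert (HX : L (S p) a (fun x => x * (F a x * q x)) = 0).
  { apply Rmult_eq_reg_l with (INR p); lra. }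
  rewrite HX in Hkey. lra.
Qed.

(** * Differentiability of the extreme zeros *)

(** Beyond the outermost root on the side [s], every linear factor has absolute value at least
    [e]. *)
Lemma prodroots_lower l x s e :
  s * s = 1 -> 0 <= e -> (forall y, In y l -> e <= s * (x - y)) ->
  e ^ length l <= Rabs (prodroots l x).
Proof.
  intros Hs He; induction l as [|z l IH]; simpl; intros H.
  - rewrite Rabs_R1. lra.
  - rewrite Rabs_mult. apply Rmult_le_compat; [exact He|now apply pow_le| |apply IH; auto].
    assert (H1 := H z (or_introl eq_refl)).
    assert (Hs1 : Rabs s = 1).
    { destruct (Rcase_abs s); [rewrite Rabs_left|rewrite Rabs_right]; nra. }
    replace (Rabs (x - z)) with (Rabs (s * (x - z))) by (rewrite Rabs_mult, Hs1; ring).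
    eapply Rle_trans; [exact H1|apply Rle_abs].
Qed.

(** [s = 1] follows the largest zero and [s = -1] the smallest. All that is known of the branch [lm]
    is [Hlm]; its regularity has to be derived from extremality. *)
Section ExtremeRoot.
Variables (p n : nat) (F dF : R -> R -> R) (s : R) (lm : R -> R) (a : R).
Hypothesis Hp : (0 < p)%nat.
Hypothesis Ha : -1 < a < 1.
Hypothesis HF : SPM (S n) F dF.
Hypothesis HO : forall b, -1 < b < 1 -> Orth p b (S n) (F b).
Hypothesis Hs : s * s = 1.
Hypothesis Hlm : forall b, -1 < b < 1 ->
  F b (lm b) = 0 /\ forall y, F b y = 0 -> s * y <= s * lm b.

Lemma family_root_inside b y : -1 < b < 1 -> F b y = 0 -> -1 < y < 1.
Proof.
  intros Hb Hy. destruct (Orth_roots p b (S n) (F b) Hb (HO b Hb)) as (l & _ & _ & Hin & E).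
  apply Hin, prodroots_root. now rewrite <- E.
Qed.

Lemma family_root_simple b y q : -1 < b < 1 -> F b y = 0 -> monic n q ->
  (forall x, F b x = (x - y) * q x) -> q y <> 0.
Proof.
  intros Hb Hy Hq E H0.
  assert (H := quotient_eval_pos p n b y (F b) q Hb (HO b Hb) Hq E). rewrite H0 in H. lra.
Qed.

(* A nearby root survives because [F a] changes sign at its simple root, and no
   root appears further out because [|F a|] is bounded below there. *)
Lemma extreme_root_continuous : continuous lm a.
Proof.
  destruct (Hlm a Ha) as (Hz & Hmax). set (z := lm a) in *.
  assert (Hzin := family_root_inside a z Ha Hz).
  destruct (monic_factor n (F a) z (Orth_monic _ _ _ _ (HO a Ha)) Hz) as (q & Hq & E).
  assert (Hqz := family_root_simple a z q Ha Hz Hq E).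
  assert (Hqc : continuous q z) by (apply (Pd_continuous (S n)); now apply monic_Pd).
  destruct (Orth_roots p a (S n) (F a) Ha (HO a Ha)) as (l & Hl & Hlen & Hin & El).
  assert (Habs : 0 < Rabs (q z)) by now apply Rabs_pos_lt.
  apply continuity_pt_filterlim in Hqc.
  destruct (Hqc (Rabs (q z)) Habs) as (d & Hd & Hqd).
  (* Simplicity of the zero: [q] keeps its sign near [z], so [(x - z) * q x] changes sign there. *)
  assert (Hsign : forall t, Rabs t < d -> 0 < q (z + t) * q z).
  { intros t Ht. destruct (Req_dec t 0) as [->|Hne].
    - rewrite Rplus_0_r. nra.
    - assert (H : R_dist (q (z + t)) (q z) < Rabs (q z)).
      { apply Hqd. split; [split; [exact I|lra]|]. simpl; unfold R_dist.
        now replace (z + t - z) with t by ring. }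
      unfold R_dist in H.
      destruct (Rcase_abs (q z)) as [Hc|Hc].
      + rewrite (Rabs_left (q z)) in H by lra. apply Rabs_def2 in H. nra.
      + rewrite (Rabs_right (q z)) in H by lra. apply Rabs_def2 in H. nra. }
  intros P (eps & HP). fold z in HP.
  (* The points [z - e] and [z + e] must stay in (-1,1), where [SP_unif] controls [F b], and in the
     neighbourhood where [q] keeps its sign. *)
  set (e := Rmin (eps / 2) (Rmin (d / 2) (Rmin ((z + 1) / 2) ((1 - z) / 2)))).
  assert (He : 0 < e /\ e < eps /\ e < d /\ e < z + 1 /\ e < 1 - z).
  { assert (Heps := cond_pos eps).
    assert (H1 := Rmin_l (eps / 2) (Rmin (d / 2) (Rmin ((z + 1) / 2) ((1 - z) / 2)))).
    assert (H2 := Rmin_r (eps / 2) (Rmin (d / 2) (Rmin ((z + 1) / 2) ((1 - z) / 2)))).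
    assert (H3 := Rmin_l (d / 2) (Rmin ((z + 1) / 2) ((1 - z) / 2))).
    assert (H4 := Rmin_r (d / 2) (Rmin ((z + 1) / 2) ((1 - z) / 2))).
    assert (H5 := Rmin_l ((z + 1) / 2) ((1 - z) / 2)).
    assert (H6 := Rmin_r ((z + 1) / 2) ((1 - z) / 2)).
    fold e in H1, H2. split; [|lra].
    unfold e. repeat apply Rmin_glb_lt; lra. }
  assert (Hsm : F a (z + e) * F a (z + - e) < 0).
  { rewrite !E.
    assert (H1 := Hsign e ltac:(rewrite Rabs_right; lra)).
    assert (H2 := Hsign (- e) ltac:(rewrite Rabs_left; lra)).
    assert (H3 : 0 < q (z + e) * q (z + - e)).
    { assert (0 < (q (z + e) * q (z + - e)) * (q z * q z)) by nra.
      assert (0 < q z * q z) by nra. nra. }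
    replace ((z + e - z) * q (z + e) * ((z + - e - z) * q (z + - e)))
      with (- (e * e * (q (z + e) * q (z + - e)))) by ring.
    assert (0 < e * e * (q (z + e) * q (z + - e))); [|lra].
    apply Rmult_lt_0_compat; [nra|exact H3]. }
  assert (Hnz1 : 0 < Rabs (F a (z + e))).
  { apply Rabs_pos_lt. intros H; rewrite H in Hsm; lra. }
  assert (Hnz2 : 0 < Rabs (F a (z + - e))).
  { apply Rabs_pos_lt. intros H; rewrite H in Hsm; lra. }
  assert (Hpw : 0 < e ^ S n) by (apply pow_lt; lra).
  (* The first two tolerances preserve the signs of [F a] at [z + e] and [z - e]; the third is the
     lower bound of [Rabs (F a)] at distance [e] or more beyond the extreme zero. *)
  assert (U1 := SP_unif _ _ _ a _ Ha (SPM_SP _ _ _ HF) Hnz1).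
  assert (U2 := SP_unif _ _ _ a _ Ha (SPM_SP _ _ _ HF) Hnz2).
  assert (U3 := SP_unif _ _ _ a _ Ha (SPM_SP _ _ _ HF) Hpw).
  change (locally a (fun b => P (lm b))).
  generalize (filter_and _ _ (filter_and _ _ U1 U2) (filter_and _ _ U3 (locally_unit a Ha))).
  apply filter_imp. intros b ((V1 & V2) & (V3 & Hb)).
  specialize (V1 (z + e) ltac:(lra)). specialize (V2 (z + - e) ltac:(lra)).
  destruct (Hlm b Hb) as (Hrb & Hmaxb).
  assert (Hrin := family_root_inside b _ Hb Hrb).
  apply HP. change (Rabs (lm b - z) < eps).
  assert (Hup : s * lm b < s * z + e).
  { destruct (Rlt_le_dec (s * lm b) (s * z + e)) as [H|H]; [exact H|exfalso].
    specialize (V3 (lm b) ltac:(lra)). rewrite Hrb, Rminus_0_l, Rabs_Ropp, El, <- Hlen in V3.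
    assert (Hlow : e ^ length l <= Rabs (prodroots l (lm b))); [|lra].
    apply (prodroots_lower l (lm b) s e Hs ltac:(lra)).
    intros y Hy. assert (Hy' : F a y = 0) by (rewrite El; now apply prodroots_root).
    specialize (Hmax y Hy'). lra. }
  assert (Hlow : exists y, z - e <= y <= z + e /\ F b y = 0).
  { assert (Hcont : Ranalysis1.continuity (F b)).
    { intros t. apply continuity_pt_filterlim.
      now apply (poly_continuous (F b)), (Orth_poly p b (S n)), HO. }
    assert (Hsb : F b (z + e) * F b (z + - e) < 0).
    { set (u := F a (z + e)) in *. set (v := F a (z + - e)) in *.
      assert (Haux : forall u u', Rabs (u' - u) < Rabs u -> 0 < u' * u).
      { clear. intros u u' H. destruct (Rcase_abs u) as [Hc|Hc].
        - rewrite (Rabs_left u) in H by lra. apply Rabs_def2 in H. nra.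
        - rewrite (Rabs_right u) in H by lra. apply Rabs_def2 in H. nra. }
      apply Haux in V1. apply Haux in V2.
      set (u' := F b (z + e)) in *. set (v' := F b (z + - e)) in *.
      clearbody u v u' v'. clear - V1 V2 Hsm.
      destruct (Rlt_le_dec u 0); destruct (Rlt_le_dec v 0); nra. }
    destruct (IVT_gen (F b) (z + - e) (z + e) 0 Hcont) as (y & Hy & Hy0).
    - unfold Rmin, Rmax. destruct (Rle_dec (F b (z + - e)) (F b (z + e))); nra.
    - exists y. rewrite Rmin_left, Rmax_right in Hy by lra. split; [lra|exact Hy0]. }
  (* Extremality of [lm b] turns the zero [y] near [z] into the missing bound
     [s * z - e <= s * lm b]. *)
  destruct Hlow as (y & Hy & Hy0). assert (H1 := Hmaxb y Hy0).
  assert (Hs1 : s = 1 \/ s = -1).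
  { destruct (Rlt_le_dec s 0); [right|left]; nra. }
  apply Rabs_def1; destruct Hs1 as [-> | ->]; lra.
Qed.

(** From [0 = (F b - F a)(lm b) + (lm b - z) q(lm b)] one solves
    [lm b = z - (F b - F a)(lm b) / q(lm b)], whose numerator vanishes at [b = a]. The derivative is
    [- dF a z / q z], nonzero by the Markov argument. *)
Lemma extreme_root_derive : exists d, d <> 0 /\ is_derive lm a d.
Proof.
  destruct (Hlm a Ha) as (Hz & Hmax). set (z := lm a) in *.
  assert (Hzin := family_root_inside a z Ha Hz).
  destruct (monic_factor n (F a) z (Orth_monic _ _ _ _ (HO a Ha)) Hz) as (q & Hq & E).
  assert (Hqz := family_root_simple a z q Ha Hz Hq E).
  assert (Hc := extreme_root_continuous).
  assert (Hqc : continuous (fun b => q (lm b)) a).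
  { apply (continuous_comp lm q); [exact Hc|].
    apply (Pd_continuous (S n)). now apply monic_Pd. }
  assert (Hdz := Markov_derivative_nonzero p n F dF a z Hp Ha Hzin HF HO Hz).
  assert (Hqinv : continuous (fun b => - / q (lm b)) a).
  { apply (continuous_opp (fun b => / q (lm b))).
    apply (continuous_comp (fun b => q (lm b)) Rinv); [exact Hqc|].
    apply continuous_Rinv. exact Hqz. }
  exists (dF a z * (- / q z)). split.
  { apply Rmult_integral_contrapositive_currified; [exact Hdz|].
    apply Ropp_neq_0_compat, Rinv_neq_0_compat, Hqz. }
  assert (HD := SP_compose_derive _ _ _ a lm Ha (SPM_SP _ _ _ HF) Hc).
  assert (HD2 := is_derive_mult_vanishing _ _ a _ HD (Rminus_diag_eq _ _ eq_refl) Hqinv).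
  assert (HD3 := is_derive_plus _ _ a _ _ HD2
    (is_derive_const (K := R_AbsRing) (V := R_NormedModule) z a)).
  replace (dF a z * - / q z) with (plus (dF a z * - / q z) (@zero R_NormedModule))
    by (unfold plus, zero; simpl; ring).
  refine (is_derive_ext_loc _ _ _ _ _ HD3).
  assert (Hnz : locally a (fun b => q (lm b) <> 0)).
  { apply (Hqc (fun y => y <> 0)). exists (mkposreal _ (Rabs_pos_lt _ Hqz)).
    intros y Hy ->. change (Rabs (0 - q z) < Rabs (q z)) in Hy.
    rewrite Rminus_0_l, Rabs_Ropp in Hy. lra. }
  generalize (filter_and _ _ Hnz (locally_unit a Ha)). apply filter_imp.
  intros b (Hqb & Hb). destruct (Hlm b Hb) as (Hrb & _).
  rewrite Hrb, E. unfold plus; simpl. field. exact Hqb.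
Qed.

End ExtremeRoot.

(** * The matrices *)

Lemma sum_kron n i v : (i <= n)%nat -> sum_f_R0 (fun j => kron i j * v j) n = v i.
Proof.
  unfold kron. induction n as [|n IH]; intros Hi.
  - replace i with 0%nat by lia. simpl. ring.
  - rewrite tech5. destruct (Nat.eqb_spec i (S n)) as [->|Hne].
    + rewrite (sum_eq _ (fun _ => 0)).
      * rewrite sum_cte. ring.
      * intros j Hj. destruct (Nat.eqb_spec (S n) j); [lia|ring].
    + rewrite IH by lia. ring.
Qed.

Lemma matvec_ext N A u v i :
  (forall j, (j <= N)%nat -> u j = v j) -> matvec N A u i = matvec N A v i.
Proof. intros E. apply sum_eq. intros j Hj. now rewrite E. Qed.

Lemma matvec_minus N A u v i :
  matvec N A (fun j => u j - v j) i = matvec N A u i - matvec N A v i.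
Proof.
  unfold matvec. rewrite <- minus_sum. apply sum_eq. intros; ring.
Qed.

Lemma sum_swap (f : nat -> nat -> R) n m :
  sum_f_R0 (fun i => sum_f_R0 (fun j => f i j) m) n
  = sum_f_R0 (fun j => sum_f_R0 (fun i => f i j) n) m.
Proof.
  induction n as [|n IH]; simpl; [reflexivity|]. rewrite IH, <- sum_plus. reflexivity.
Qed.

Lemma matvec_matmul N A B v i :
  matvec N (matmul N A B) v i = matvec N A (matvec N B v) i.
Proof.
  unfold matvec, matmul.
  rewrite (sum_eq _ (fun l => sum_f_R0 (fun k => A i k * B k l * v l) N)).
  - rewrite sum_swap. apply sum_eq. intros k _. rewrite scal_sum.
    apply sum_eq. intros; ring.
  - intros l _. rewrite Rmult_comm, scal_sum. reflexivity.
Qed.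

(** Both halves can be checked by solving the system, without determinants; [matinv_spec] converts
    them into the two-sided inverse that [matinv] asks for. *)
Definition invertible (N : nat) (D : nat -> nat -> R) : Prop :=
  (forall v, (forall i, (i <= N)%nat -> matvec N D v i = 0) ->
     forall i, (i <= N)%nat -> v i = 0) /\
  (forall v, exists u, forall i, (i <= N)%nat -> matvec N D u i = v i).

Lemma matinv_spec N D : invertible N D ->
  forall i j, (i <= N)%nat -> (j <= N)%nat ->
    matmul N (matinv N D) D i j = kron i j /\ matmul N D (matinv N D) i j = kron i j.
Proof.
  intros (Hinj & Hsurj). unfold matinv. apply epsilon_spec.
  destruct (ClassicalEpsilon.choice (fun j u => forall i, (i <= N)%nat ->
    matvec N D u i = kron i j)) as (U & HU).
  { intros j. apply (Hsurj (fun i => kron i j)). }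
  exists (fun i j => U j i). intros i j Hi Hj.
  split; [|exact (HU j i Hi)].
  (* The columns solve [D u = e_j], so [U] is a right inverse; [D (U D - I) = 0] and injectivity
     make it a left inverse too. *)
  enough (matmul N (fun i j => U j i) D i j - kron i j = 0) by lra.
  apply (Hinj (fun i => matmul N (fun i j => U j i) D i j - kron i j)); [|exact Hi].
  clear i Hi. intros i Hi. rewrite matvec_minus.
  change (matvec N D (fun i => matmul N (fun i j => U j i) D i j) i)
    with (matvec N D (matvec N (fun i j => U j i) (fun l => D l j)) i).
  rewrite <- matvec_matmul.
  replace (matvec N (matmul N D (fun i j => U j i)) (fun l => D l j) i) with (D i j).
  - replace (matvec N D (fun i => kron i j) i) with (D i j); [ring|].
    unfold matvec. rewrite <- (sum_kron N j (fun l => D i l)) by assumption.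
    apply sum_eq. intros l _. unfold kron. rewrite Nat.eqb_sym. ring.
  - rewrite <- (sum_kron N i (fun l => D l j)) by assumption.
    apply sum_eq. intros l Hl. f_equal. symmetry. exact (HU l i Hi).
Qed.

Lemma matinv_l N D v i : invertible N D -> (i <= N)%nat ->
  matvec N (matinv N D) (matvec N D v) i = v i.
Proof.
  intros HD Hi. rewrite <- matvec_matmul, <- (sum_kron N i v) by assumption.
  apply sum_eq. intros j Hj. f_equal. now apply matinv_spec.
Qed.

Lemma matinv_r N D v i : invertible N D -> (i <= N)%nat ->
  matvec N D (matvec N (matinv N D) v) i = v i.
Proof.
  intros HD Hi. rewrite <- matvec_matmul, <- (sum_kron N i v) by assumption.
  apply sum_eq. intros j Hj. f_equal. now apply matinv_spec.
Qed.

Lemma conj_eigenvector N D M v l : invertible N D ->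
  (forall i, (i <= N)%nat -> matvec N (matmul N (matinv N D) (matmul N M D)) v i = l * v i) <->
  (forall i, (i <= N)%nat -> matvec N M (matvec N D v) i = l * matvec N D v i).
Proof.
  intros HD.
  assert (Hscal : forall A (u : nat -> R) i, matvec N A (fun j => l * u j) i = l * matvec N A u i).
  { intros A u i. unfold matvec. rewrite scal_sum. apply sum_eq. intros; ring. }
  split; intros H i Hi.
  - rewrite <- (matinv_r N D _ i HD Hi), <- Hscal. apply matvec_ext. intros j Hj.
    rewrite <- (H j Hj), matvec_matmul. apply matvec_ext. intros k Hk.
    now rewrite matvec_matmul.
  - rewrite matvec_matmul, <- (matinv_l N D v i HD Hi), <- Hscal.
    apply matvec_ext. intros j Hj. rewrite matvec_matmul. now apply H.
Qed.

Lemma Lambda_t_matvec N a v i : (i <= N)%nat ->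
  matvec N (Lambda_t a) v i = Kint 5 a i i * v i.
Proof.
  intros Hi. rewrite <- (sum_kron N i v) by assumption. rewrite scal_sum.
  apply sum_eq. intros j _. unfold Lambda_t, kron. destruct (Nat.eqb i j); ring.
Qed.

Lemma Lambda_t_invertible N a : -1 < a < 1 -> invertible N (Lambda_t a).
Proof.
  intros Ha. split.
  - intros v H i Hi. specialize (H i Hi). rewrite Lambda_t_matvec in H by assumption.
    assert (HK := Kint_pos 5 a i Ha). apply Rmult_integral in H. destruct H; lra.
  - intros v. exists (fun i => v i / Kint 5 a i i). intros i Hi.
    rewrite Lambda_t_matvec by assumption. assert (HK := Kint_pos 5 a i Ha). field. lra.
Qed.

(** * Rows and invertibility of [Dt] *)

Lemma Dt_row0 N w v : (1 <= N)%nat ->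
  matvec N (Dt N w) v 0
  = beta (alpha_of w) 0 * v 0%nat + gamma (alpha_of w) 0 * f_of w 0 * v 1%nat.
Proof.
  intros HN. rewrite <- (sum_kron N 0 v), <- (sum_kron N 1 v) by lia.
  rewrite !scal_sum, <- sum_plus. apply sum_eq. intros [|[|j]] _; unfold Dt, kron; simpl; ring.
Qed.

Lemma Dt_row1 N w v : (1 <= N)%nat ->
  matvec N (Dt N w) v 1 = alpha_of w * v 0%nat - 4 * f_of w 0 * v 1%nat.
Proof.
  intros HN. replace (alpha_of w * v 0%nat - 4 * f_of w 0 * v 1%nat)
    with (alpha_of w * v 0%nat + (- 4 * f_of w 0) * v 1%nat) by ring.
  rewrite <- (sum_kron N 0 v), <- (sum_kron N 1 v) by lia.
  rewrite !scal_sum, <- sum_plus. apply sum_eq. intros [|[|j]] _; unfold Dt, kron; simpl; ring.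
Qed.

(** For [i = 2] the subdiagonal position is column 1, already filled by the parameter column; the
    test [3 <= i] keeps [v 1] from being counted twice. *)
Lemma Dt_row N w v i : (2 <= i <= N)%nat ->
  matvec N (Dt N w) v i
  = (gamma (alpha_of w) i * f_of w i - 4 * f_of w (i - 1)) * v 1%nat
    + (beta (alpha_of w) i * v i
       + (if Nat.leb 3 i then alpha_of w else 0) * v (i - 1)%nat).
Proof.
  intros Hi. rewrite <- (sum_kron N 1 v), <- (sum_kron N i v), <- (sum_kron N (i - 1) v) at 1 by lia.
  rewrite !scal_sum, <- !sum_plus. apply sum_eq. intros j _. unfold Dt, kron.
  destruct (Nat.eqb_spec i 0); [lia|]. destruct (Nat.eqb_spec i 1); [lia|].
  destruct (Nat.leb_spec i N); [|lia].
  destruct (Nat.eqb_spec j 1); destruct (Nat.eqb_spec 1 j); try lia;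
  destruct (Nat.eqb_spec j i); destruct (Nat.eqb_spec i j); try lia;
  destruct (Nat.leb_spec 3 i); destruct (Nat.eqb_spec j (i - 1));
  destruct (Nat.eqb_spec (i - 1) j); try lia; simpl; ring.
Qed.

Lemma phi_0 p a x : -1 < a < 1 -> phi p a 0 x = 1.
Proof. intros Ha. assert (H := proj1 (phi_Orth p a 0 Ha) x). simpl in H. lra. Qed.

Lemma Kint_00 p a : -1 < a < 1 -> Kint p a 0 0 = L p a (fun _ => 1).
Proof.
  intros Ha. rewrite Kint_L by assumption. apply L_ext. intros x _.
  rewrite phi_0 by assumption. simpl; ring.
Qed.

Lemma dK_0 a : -1 < a < 1 -> dK a 0 = - 4 * L 5 a (fun x => x).
Proof.
  intros Ha.
  assert (H : derivable_pt_lim (fun b => Kint 4 b 0 0) a (- 4 * L 5 a (fun x => x))).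
  { apply is_derive_Reals.
    apply is_derive_ext_loc with (fun b => L 4 b (fun x => x ^ 0)).
    - generalize (locally_unit a Ha). apply filter_imp. intros b Hb.
      now rewrite Kint_00.
    - assert (HD := moment_is_derive 4 a 0 Ha).
      rewrite (L_ext 5 a _ (fun x => x)) in HD by (intros; simpl; ring).
      replace (-4) with (- INR 4) by (simpl; ring). exact HD. }
  apply (uniqueness_limite (fun b => Kint 4 b 0 0) a); [|exact H].
  unfold dK. apply epsilon_spec. eexists; exact H.
Qed.

Lemma Kint_4_00 a : -1 < a < 1 ->
  Kint 4 a 0 0 = L 5 a (fun _ => 1) + a * L 5 a (fun x => x).
Proof.
  intros Ha. rewrite Kint_00, L_weight_S by assumption.
  rewrite (L_ext 5 a _ (fun x => 1 + a * x)) by (intros; ring).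
  rewrite L_plus, L_scal; try assumption; try polyt. reflexivity.
Qed.

(* This makes the leading 2x2 block of [Dt] have determinant [-4 f_0]. *)
Lemma beta_gamma_0 a : -1 < a < 1 -> 4 * beta a 0 + a * gamma a 0 = 4.
Proof.
  (* With [m0], [m1] the moments of exponent 5: [beta_0 = 1 + a m1 / m0] and
     [gamma_0 = -4 m1 / m0]. *)
  intros Ha. unfold beta, gamma. rewrite dK_0, Kint_4_00 by assumption.
  assert (HK := Kint_pos 5 a 0 Ha). rewrite Kint_00 in * by assumption. field. lra.
Qed.

Lemma beta_pos a k : -1 < a < 1 -> 0 < beta a k.
Proof.
  intros Ha. apply Rdiv_lt_0_compat; now apply Kint_pos.
Qed.

(** [Dt] is block lower triangular: below the leading 2x2 block, each row brings one new unknown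
    with the positive diagonal entry [beta]. Both halves are forward substitution. *)
Lemma Dt_invertible N w :
  (1 <= N)%nat -> -1 < alpha_of w < 1 -> f_of w 0 <> 0 -> invertible N (Dt N w).
Proof.
  intros HN Ha Hf. assert (Hbg := beta_gamma_0 _ Ha).
  assert (Hb := fun k => beta_pos _ k Ha).
  set (a := alpha_of w) in *. assert (Hb0 := Hb 0%nat).
  split.
  - intros v H.
    assert (H0 := H 0%nat ltac:(lia)). rewrite Dt_row0 in H0 by assumption. fold a in H0.
    assert (H1 := H 1%nat HN). rewrite Dt_row1 in H1 by assumption. fold a in H1.
    assert (Hv1 : v 1%nat = 0).
    (* Eliminating [v 0] from the first two rows leaves [(4 beta_0 + a gamma_0) f_0 v_1]. *)
    { apply Rmult_eq_reg_l with (4 * f_of w 0); [|nra]. rewrite Rmult_0_r, <- Hbg at 1.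
      replace ((4 * beta a 0 + a * gamma a 0) * f_of w 0 * v 1%nat)
        with (a * (beta a 0 * v 0%nat + gamma a 0 * f_of w 0 * v 1%nat)
              - beta a 0 * (a * v 0%nat - 4 * f_of w 0 * v 1%nat)) by ring.
      rewrite H0, H1. ring. }
    assert (Hv0 : v 0%nat = 0).
    { rewrite Hv1 in H0. apply Rmult_eq_reg_l with (beta a 0); lra. }
    intros i; induction i as [|i IH]; intros Hi; [exact Hv0|].
    destruct i as [|i]; [exact Hv1|].
    assert (H2 := H _ Hi). rewrite Dt_row in H2 by lia. fold a in H2.
    replace (S (S i) - 1)%nat with (S i) in H2 by lia.
    rewrite Hv1, IH in H2 by lia. assert (H3 := Hb (S (S i))).
    apply Rmult_eq_reg_l with (beta a (S (S i))); lra.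
  - intros v.
    (* Cramer's rule for the 2x2 block gives entry 1; row 0 then gives entry 0. *)
    set (u1 := (a * v 0%nat - beta a 0 * v 1%nat) / (4 * f_of w 0)).
    set (u0 := (v 0%nat - gamma a 0 * f_of w 0 * u1) / beta a 0).
    (* [step n r] computes entry [S n] from the value [r] of entry [n]; for [n = 0] it returns [u1],
       already determined by the 2x2 block. *)
    set (step := fun (n : nat) (r : R) =>
      if Nat.eqb n 0 then u1 else
      (v (S n) - (gamma a (S n) * f_of w (S n) - 4 * f_of w (S n - 1)) * u1
       - (if Nat.leb 3 (S n) then a else 0) * r) / beta a (S n)).
    exists (nat_rect (fun _ => R) u0 step). intros [|[|i]] Hi.
    + rewrite Dt_row0 by assumption. fold a. change (beta a 0 * u0 + gamma a 0 * f_of w 0 * u1 = v 0%nat). unfold u0. field. lra.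
    + rewrite Dt_row1 by assumption. fold a. simpl.
      change (a * u0 - 4 * f_of w 0 * u1 = v 1%nat).
      apply Rmult_eq_reg_l with (beta a 0); [|lra].
      replace (beta a 0 * (a * u0 - 4 * f_of w 0 * u1))
        with (a * v 0%nat - (4 * beta a 0 + a * gamma a 0) * f_of w 0 * u1)
        by (unfold u0; field; lra).
      rewrite Hbg. unfold u1. field. exact Hf.
    + rewrite Dt_row by lia. fold a.
      set (U := nat_rect (fun _ => R) u0 step).
      change (U 1%nat) with u1. change (U (S (S i))) with (step (S i) (U (S i))).
      replace (S (S i) - 1)%nat with (S i) by lia.
      unfold step. change (Nat.eqb (S i) 0) with false. cbv iota.
      replace (S (S i) - 1)%nat with (S i) by lia.
      assert (H3 := Hb (S (S i))). field. lra.
Qed.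

(** * Eigenvalues and eigenvectors *)

(** The factor vanishes at [z] itself, so the zeros of [f] are collected at the points [z + 1 + i]
    instead. *)
Lemma Pd_linear_cancel n f z :
  Pd n f -> (forall x, (x - z) * f x = 0) -> forall x, f x = 0.
Proof.
  intros Hf H.
  apply (Pd_roots_zero n f (map (fun i => z + 1 + INR i) (seq 0 n)) Hf).
  - apply Injective_map_NoDup; [|apply seq_NoDup]. intros i j E. apply INR_eq. lra.
  - now rewrite length_map, length_seq.
  - intros y Hy. apply in_map_iff in Hy. destruct Hy as (i & <- & _).
    assert (Hi := pos_INR i). specialize (H (z + 1 + INR i)).
    apply Rmult_integral in H. destruct H; [lra|assumption].
Qed.

Lemma phi_poly p a k : -1 < a < 1 -> poly (phi p a k).
Proof. intros Ha. exact (Orth_poly _ _ _ _ (phi_Orth p a k Ha)). Qed.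

Lemma phi_Pd p a k : -1 < a < 1 -> Pd (S k) (phi p a k).
Proof. intros Ha. exact (monic_Pd _ _ (Orth_monic _ _ _ _ (phi_Orth p a k Ha))). Qed.

Lemma phi_orthogonal p a i j : -1 < a < 1 ->
  L p a (fun x => phi p a i x * phi p a j x) = Kint p a i i * kron i j.
Proof.
  intros Ha. unfold kron. destruct (Nat.eqb_spec i j) as [->|Hne].
  - rewrite Kint_norm by assumption. ring.
  - rewrite Rmult_0_r. destruct (Nat.lt_ge_cases i j) as [Hlt|Hge].
    + rewrite (L_ext p a _ (fun x => phi p a j x * phi p a i x)) by (intros; ring).
      apply (proj2 (phi_Orth p a j Ha)). apply Pd_le with (S i); [lia|now apply phi_Pd].
    + apply (proj2 (phi_Orth p a i Ha)). apply Pd_le with (S j); [lia|now apply phi_Pd].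
Qed.

(** [phi_0, ..., phi_n] span the polynomials of degree [<= n], so [r] is orthogonal to itself. *)
Lemma Pd_orthogonal_zero p a n r : -1 < a < 1 -> Pd (S n) r ->
  (forall i, (i <= n)%nat -> L p a (fun x => phi p a i x * r x) = 0) -> forall x, r x = 0.
Proof.
  intros Ha Hr H. assert (Hrp := Pd_poly _ _ Hr).
  assert (Hall : forall m, (m <= S n)%nat -> forall g, Pd m g ->
    L p a (fun x => g x * r x) = 0).
  { induction m as [|m IH]; intros Hm g Hg.
    - rewrite (L_ext p a _ (fun _ => 0)); [apply L_zero|].
      intros x _. simpl in Hg. rewrite Hg. ring.
    - destruct (Pd_split m g (phi p a m) Hg (Orth_monic _ _ _ _ (phi_Orth p a m Ha)))
        as (c & s & Hs & E).
      assert (Hph := phi_poly p a m Ha).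
      rewrite (L_ext p a _ (fun x => c * (phi p a m x * r x) + s x * r x))
        by (intros; rewrite E; ring).
      rewrite L_plus, L_scal, H, (IH ltac:(lia) s Hs); try assumption; try polyt; [ring|lia]. }
  intros x. apply NNPP. intros Hx.
  assert (Hpos := L_sqr_pos p a r Ha Hrp (ex_intro _ x Hx)).
  rewrite (Hall (S n) (le_n _) r Hr) in Hpos. lra.
Qed.

Definition expansion (N : nat) (a : R) (u : nat -> R) (x : R) : R :=
  sum_f_R0 (fun j => u j * phi 5 a j x) N.

Lemma expansion_Pd N a u : -1 < a < 1 -> Pd (S N) (expansion N a u).
Proof.
  intros Ha. apply Pd_sum. intros i Hi. apply Pd_le with (S i); [lia|now apply phi_Pd].
Qed.

Lemma expansion_coef N a u i : -1 < a < 1 -> (i <= N)%nat ->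
  L 5 a (fun x => phi 5 a i x * expansion N a u x) = Kint 5 a i i * u i.
Proof.
  intros Ha Hi. assert (Hph := fun j => phi_poly 5 a j Ha).
  rewrite (L_ext 5 a _
    (fun x => sum_f_R0 (fun j => u j * (phi 5 a i x * phi 5 a j x)) N)).
  - rewrite (L_sum 5 a N u (fun j x => phi 5 a i x * phi 5 a j x) Ha)
      by (intros; apply poly_mult; apply Hph).
    rewrite <- (sum_kron N i u Hi), scal_sum. apply sum_eq. intros j _.
    rewrite phi_orthogonal by assumption. ring.
  - intros x _. unfold expansion. rewrite scal_sum. apply sum_eq. intros; ring.
Qed.

Lemma Gmat_matvec N a u i : -1 < a < 1 ->
  matvec N (Gmat a) u i = L 5 a (fun x => phi 5 a i x * (x * expansion N a u x)).
Proof.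
  intros Ha. assert (Hph := fun j => phi_poly 5 a j Ha).
  rewrite (L_ext 5 a _
    (fun x => sum_f_R0 (fun j => u j * (x * phi 5 a i x * phi 5 a j x)) N)).
  - rewrite (L_sum 5 a N u (fun j x => x * phi 5 a i x * phi 5 a j x) Ha).
    + apply sum_eq. intros j _. unfold Gmat.
      rewrite (Int_L 5 a (fun x => x * phi 5 a i x * phi 5 a j x)); [ring|assumption| |reflexivity].
      apply poly_mult; [apply poly_mult; [apply poly_id|]|]; apply Hph.
    + intros j _. apply poly_mult; [apply poly_mult; [apply poly_id|]|]; apply Hph.
  - intros x _. unfold expansion. rewrite <- Rmult_assoc, scal_sum.
    apply sum_eq. intros; ring.
Qed.

(** [Gmat] is multiplication by [x] tested against each [phi_i], and [Lambda_t] holds the squared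
    norms. Row [i] of the eigenvalue equation, multiplied by [Kint 5 a i i], is therefore the
    orthogonality of [(x - l) e] to [phi_i]. *)
Lemma Mt_eigenvector N w u l : -1 < alpha_of w < 1 ->
  (forall i, (i <= N)%nat -> matvec N (Mt N w) u i = l * u i) <->
  (forall i, (i <= N)%nat ->
     L 5 (alpha_of w) (fun x => phi 5 (alpha_of w) i x
        * ((x - l) * expansion N (alpha_of w) u x)) = 0).
Proof.
  intros Ha. set (a := alpha_of w) in *.
  assert (Hinv := Lambda_t_invertible N a Ha).
  assert (Hex := Pd_poly _ _ (expansion_Pd N a u Ha)).
  assert (Hrow : forall i, (i <= N)%nat ->
    L 5 a (fun x => phi 5 a i x * ((x - l) * expansion N a u x))
    = Kint 5 a i i * (matvec N (Mt N w) u i - l * u i)).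
  { intros i Hi. assert (Hph := phi_poly 5 a i Ha).
    rewrite (L_ext 5 a _ (fun x => phi 5 a i x * (x * expansion N a u x)
      - l * (phi 5 a i x * expansion N a u x))) by (intros; ring).
    rewrite L_minus, L_scal, expansion_coef, <- Gmat_matvec; try assumption; try polyt.
    rewrite Rmult_minus_distr_l, <- (Lambda_t_matvec N a (matvec N (Mt N w) u) i Hi).
    unfold Mt. fold a.
    rewrite (matvec_ext N (Lambda_t a) (matvec N _ u) (matvec N (matinv N (Lambda_t a)) (matvec N (Gmat a) u)))
      by (intros; apply matvec_matmul).
    rewrite matinv_r by assumption. ring. }
  split; intros H i Hi.
  - rewrite Hrow, H by assumption. ring.
  - specialize (H i Hi). rewrite Hrow in H by assumption.
    assert (HK := Kint_pos 5 a i Ha). apply Rmult_integral in H. destruct H; lra.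
Qed.

Lemma Mt_eigenvector_form N w u l : -1 < alpha_of w < 1 ->
  (exists i, (i <= N)%nat /\ u i <> 0) ->
  (forall i, (i <= N)%nat -> matvec N (Mt N w) u i = l * u i) ->
  phi 5 (alpha_of w) (S N) l = 0 /\
  exists c, c <> 0 /\ forall i, (i <= N)%nat ->
    Kint 5 (alpha_of w) i i * u i = c * phi 5 (alpha_of w) i l.
Proof.
  intros Ha (i0 & Hi0 & Hu) H. assert (H' := proj1 (Mt_eigenvector N w u l Ha) H). clear H; rename H' into H.
  set (a := alpha_of w) in *. set (e := expansion N a u) in *.
  assert (He : Pd (S N) e) by now apply expansion_Pd.
  assert (Hep := Pd_poly _ _ He).
  assert (HO := phi_Orth 5 a (S N) Ha). set (P := phi 5 a (S N)) in *.
  assert (HPp := Orth_poly _ _ _ _ HO).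
  assert (Hle : Pd (S (S N)) (fun x => (x - l) * e x))
    by exact (Pd_mult 1 (S N) _ _ (Pd_linear l) He).
  (* Division by [P]: the remainder has degree [<= N] and is orthogonal to [phi_0, ..., phi_N],
     hence 0. *)
  destruct (Pd_split (S N) _ P Hle (Orth_monic _ _ _ _ HO)) as (c & r & Hr & E).
  assert (Hr0 : forall x, r x = 0).
  { apply (Pd_orthogonal_zero 5 a N r Ha Hr). intros i Hi.
    assert (Hph := phi_poly 5 a i Ha). assert (Hrp := Pd_poly _ _ Hr).
    rewrite (L_ext 5 a _ (fun x => phi 5 a i x * ((x - l) * e x) - c * (P x * phi 5 a i x)))
      by (intros x _; rewrite E; ring).
    rewrite L_minus, L_scal, H, (proj2 HO); try assumption; try polyt; [ring|].
    apply Pd_le with (S i); [lia|now apply phi_Pd]. }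
  assert (Hc : c <> 0).
  { intros Hc. apply Hu. assert (He0 : forall x, e x = 0).
    { apply (Pd_linear_cancel (S N) e l He). intros x. rewrite E, Hc, Hr0. ring. }
    assert (HK := Kint_pos 5 a i0 Ha).
    apply Rmult_eq_reg_l with (Kint 5 a i0 i0); [|lra].
    rewrite <- (expansion_coef N a u i0 Ha Hi0), Rmult_0_r.
    rewrite (L_ext 5 a _ (fun _ => 0)); [apply L_zero|].
    intros x _. fold e. rewrite He0. ring. }
  assert (HPl : P l = 0).
  { assert (H0 := E l). rewrite Hr0 in H0. apply Rmult_eq_reg_l with c; [|assumption]. lra. }
  split; [exact HPl|].
  destruct (monic_factor N P l (Orth_monic _ _ _ _ HO) HPl) as (q & Hq & Eq).
  assert (Hqp := Pd_poly _ _ (monic_Pd _ _ Hq)).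
  assert (Heq : forall x, e x - c * q x = 0).
  { apply (Pd_linear_cancel (S N) (fun x => e x - c * q x) l).
    - apply Pd_minus; [exact He|]. apply Pd_scal, monic_Pd, Hq.
    - intros x. replace ((x - l) * (e x - c * q x))
        with ((x - l) * e x - c * ((x - l) * q x)) by ring.
      rewrite E, <- Eq, Hr0. ring. }
  (* Since [e = c q], [quotient_eval] gives [c * phi_i(l) * L 5 a q] for the integral of
     [phi_i e]. *)
  exists (c * L 5 a q). split.
  - apply Rmult_integral_contrapositive_currified; [exact Hc|]. intros H0.
    assert (H1 := quotient_eval_pos 5 N a l P q Ha HO Hq Eq). rewrite H0 in H1. lra.
  - intros i Hi. assert (Hph := phi_poly 5 a i Ha).
    rewrite <- (expansion_coef N a u i Ha Hi). fold e.
    rewrite (L_ext 5 a _ (fun x => c * (phi 5 a i x * q x)))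
      by (intros x _; specialize (Heq x); replace (e x) with (c * q x) by lra; ring).
    rewrite L_scal by (assumption || polyt).
    rewrite (quotient_eval 5 N a l P q Ha HO Hq Eq); [ring|].
    apply Pd_le with (S i); [lia|now apply phi_Pd].
Qed.

Lemma Mt_eigenvector_exists N w l : -1 < alpha_of w < 1 ->
  phi 5 (alpha_of w) (S N) l = 0 ->
  exists u, (exists i, (i <= N)%nat /\ u i <> 0) /\
    forall i, (i <= N)%nat -> matvec N (Mt N w) u i = l * u i.
Proof.
  intros Ha HPl. set (a := alpha_of w) in *.
  assert (HO := phi_Orth 5 a (S N) Ha). set (P := phi 5 a (S N)) in *.
  destruct (monic_factor N P l (Orth_monic _ _ _ _ HO) HPl) as (q & Hq & Eq).
  assert (Hqd := monic_Pd _ _ Hq). assert (Hqp := Pd_poly _ _ Hqd).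
  (* The Fourier coefficients of [q]. The one of index 0 is [L 5 a q / Kint 5 a 0 0], nonzero by
     [quotient_eval_pos]. *)
  set (u := fun j => L 5 a (fun x => phi 5 a j x * q x) / Kint 5 a j j).
  assert (He := expansion_Pd N a u Ha). assert (Hep := Pd_poly _ _ He).
  assert (Heq : forall x, q x - expansion N a u x = 0).
  { apply (Pd_orthogonal_zero 5 a N (fun x => q x - expansion N a u x) Ha).
    - now apply Pd_minus.
    - intros i Hi. assert (Hph := phi_poly 5 a i Ha).
      rewrite (L_ext 5 a _ (fun x => phi 5 a i x * q x - phi 5 a i x * expansion N a u x))
        by (intros; ring).
      rewrite L_minus, expansion_coef; try assumption; try polyt.
      unfold u. assert (HK := Kint_pos 5 a i Ha). field. lra. }
  exists u. split.
  - exists 0%nat. split; [lia|]. unfold u. assert (HK := Kint_pos 5 a 0 Ha).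
    rewrite (L_ext 5 a _ q) by (intros; rewrite phi_0 by assumption; ring).
    intros H0. assert (H1 := quotient_eval_pos 5 N a l P q Ha HO Hq Eq).
    assert (H2 : L 5 a q = 0).
    { replace (L 5 a q) with (L 5 a q / Kint 5 a 0 0 * Kint 5 a 0 0) by (field; lra).
      rewrite H0. ring. }
    rewrite H2 in H1. lra.
  - apply (Mt_eigenvector N w u l Ha). intros i Hi. fold a.
    rewrite (L_ext 5 a _ (fun x => P x * phi 5 a i x)).
    + apply (proj2 HO). apply Pd_le with (S i); [lia|now apply phi_Pd].
    + intros x _. rewrite Eq. specialize (Heq x).
      replace (expansion N a u x) with (q x) by lra. ring.
Qed.

Lemma is_eig_root N w l :
  (1 <= N)%nat -> -1 < alpha_of w < 1 -> f_of w 0 <> 0 ->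
  is_eig N (Amat N w) l <-> phi 5 (alpha_of w) (S N) l = 0.
Proof.
  intros HN Ha Hf. assert (HD := Dt_invertible N w HN Ha Hf). split.
  - intros (v & (i & Hi & Hv) & H).
    refine (proj1 (Mt_eigenvector_form N w _ l Ha _
      (proj1 (conj_eigenvector N (Dt N w) (Mt N w) v l HD) H))).
    destruct (classic (exists i, (i <= N)%nat /\ matvec N (Dt N w) v i <> 0)) as [?|Hn];
      [assumption|exfalso].
    apply Hv. apply (proj1 HD v); [|exact Hi]. intros j Hj.
    apply NNPP. intros Hj0. apply Hn. now exists j.
  - intros HP. destruct (Mt_eigenvector_exists N w l Ha HP) as (u & (i & Hi & Hu) & H).
    destruct (proj2 HD u) as (v & Hv). exists v. split.
    + destruct (classic (exists i, (i <= N)%nat /\ v i <> 0)) as [?|Hn]; [assumption|exfalso].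
      apply Hu. rewrite <- (Hv i Hi). rewrite (matvec_ext N _ v (fun _ => 0)).
      * unfold matvec. rewrite (sum_eq _ (fun _ => 0)) by (intros; ring). rewrite sum_cte. ring.
      * intros j Hj. apply NNPP. intros Hj0. apply Hn. now exists j.
    + apply (conj_eigenvector N (Dt N w) (Mt N w) v l HD). intros j Hj.
      rewrite (Hv j Hj), <- (H j Hj). apply matvec_ext. exact Hv.
Qed.

(** * Extreme eigenvalues and their eigenvectors *)

Lemma exists_extremum (l : list R) : l <> nil ->
  forall s, exists z, In z l /\ forall y, In y l -> s * y <= s * z.
Proof.
  intros Hl s; induction l as [|x l IH]; [easy|].
  destruct l as [|y l].
  - exists x. split; [now left|]. intros y [->|[]]. lra.
  - destruct IH as (z & Hz & Hmax); [easy|].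
    destruct (Rle_lt_dec (s * x) (s * z)) as [H|H].
    + exists z. split; [now right|]. intros t [<-|Ht]; auto.
    + exists x. split; [now left|]. intros t [<-|Ht]; [lra|].
      specialize (Hmax t Ht). lra.
Qed.

Definition ext_sign (k : nat) : R := if Nat.eqb k 0 then -1 else 1.

(** [lam] is only an [epsilon] choice, so a [k]-th eigenvalue must first be exhibited: below the
    smallest zero there is nothing, below the largest lie the other [N]. Counting then forces the
    chosen value to be extreme. *)
Lemma lam_extreme N k w :
  (1 <= N)%nat -> (k = 0%nat \/ k = N) -> -1 < alpha_of w < 1 -> f_of w 0 <> 0 ->
  phi 5 (alpha_of w) (S N) (lam N k w) = 0 /\
  forall y, phi 5 (alpha_of w) (S N) y = 0 -> ext_sign k * y <= ext_sign k * lam N k w.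
Proof.
  intros HN Hk Ha Hf.
  assert (Heig := fun l => is_eig_root N w l HN Ha Hf).
  set (P := phi 5 (alpha_of w) (S N)) in *.
  destruct (Orth_roots 5 _ (S N) P Ha (phi_Orth 5 _ (S N) Ha)) as (l & Hl & Hlen & _ & E).
  assert (Hroot : forall y, In y l <-> P y = 0).
  { intros y. rewrite E. symmetry. apply prodroots_root. }
  assert (Hex : exists z, kth_eig N (Amat N w) k z).
  { destruct (exists_extremum l ltac:(intros ->; simpl in Hlen; lia) (ext_sign k)) as (z & Hz & Hmax).
    exists z. split; [apply Heig; now apply Hroot|].
    destruct Hk as [-> | ->].
    - exists nil. split; [constructor|]. split; [reflexivity|]. intros m. split; [easy|].
      intros (Hm & Hlt). apply Heig, Hroot, Hmax in Hm. unfold ext_sign in Hm. simpl in Hm. lra.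
    - unfold ext_sign in Hmax. destruct (Nat.eqb_spec N 0); [lia|].
      assert (Hz' := Hz). apply in_split in Hz'. destruct Hz' as (l1 & l2 & El).
      assert (Hl' := Hl). rewrite El in Hl'. exists (l1 ++ l2).
      split; [now apply NoDup_remove_1 in Hl'|]. split.
      + rewrite El, length_app in Hlen. rewrite length_app. simpl in Hlen. lia.
      + intros m. apply NoDup_remove_2 in Hl'. rewrite Heig, <- Hroot. split.
        * intros Hm. assert (Hml : In m l).
          { rewrite El. apply in_app_iff. apply in_app_iff in Hm. simpl. tauto. }
          split; [exact Hml|]. specialize (Hmax m Hml).
          assert (m <> z) by (intros ->; now apply Hl'). lra.
        * intros (Hm & Hlt). rewrite El in Hm. apply in_app_iff in Hm. apply in_app_iff.
          simpl in Hm. destruct Hm as [?|[->|?]]; [tauto|lra|tauto]. }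
  assert (Hlam : kth_eig N (Amat N w) k (lam N k w)) by exact (epsilon_spec _ _ Hex).
  clear Hex. destruct Hlam as (He & s & Hs & Hslen & Hsin).
  apply Heig in He. split; [exact He|]. intros y Hy.
  destruct Hk as [-> | ->]; unfold ext_sign.
  - simpl. destruct (Rlt_le_dec y (lam N 0 w)) as [Hlt|Hge]; [exfalso|lra].
    destruct s; [|easy]. apply (proj2 (Hsin y)). split; [now apply Heig|exact Hlt].
  - destruct (Nat.eqb_spec N 0); [lia|].
    destruct (Rle_lt_dec y (lam N N w)) as [Hle|Hgt]; [lra|exfalso].
    set (z := lam N N w) in *.
    (* A zero above [z], [z] itself and the [N] eigenvalues below it would be [N + 2] distinct zeros
       in degree [N + 1]. *)
    assert (Hnd : NoDup (y :: z :: s)).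
    { constructor; [|constructor; [|exact Hs]].
      - intros [->|Hin]; [lra|]. apply Hsin in Hin. lra.
      - intros Hin. apply Hsin in Hin. lra. }
    assert (Hincl : incl (y :: z :: s) l).
    { intros t [<-|[<-|Ht]]; [now apply Hroot|now apply Hroot|].
      apply Hroot, Heig, Hsin, Ht. }
    assert (Hlen2 := NoDup_incl_length Hnd Hincl). simpl in Hlen2. lia.
Qed.

Lemma ext_sign_sqr k : ext_sign k * ext_sign k = 1.
Proof. unfold ext_sign. destruct (Nat.eqb k 0); ring. Qed.

Lemma lam_alpha N k w w' :
  (1 <= N)%nat -> (k = 0%nat \/ k = N) -> -1 < alpha_of w < 1 ->
  f_of w 0 <> 0 -> f_of w' 0 <> 0 -> alpha_of w' = alpha_of w ->
  lam N k w' = lam N k w.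
Proof.
  intros HN Hk Ha Hf Hf' E.
  destruct (lam_extreme N k w HN Hk Ha Hf) as (H1 & H2).
  destruct (lam_extreme N k w' HN Hk ltac:(now rewrite E) Hf') as (H3 & H4).
  rewrite E in H3, H4. specialize (H2 _ H3). specialize (H4 _ H1).
  assert (Hs := ext_sign_sqr k).
  apply Rmult_eq_reg_l with (ext_sign k); [lra|]. intros H0; rewrite H0 in Hs; lra.
Qed.

(** With [Rv 1 = 0] and [r = Rv 0], the first two entries of [Dt Rv] are [beta_0 r] and [a r]. They
    must equal [c / K_00] and [c phi_1(l) / K_11] (exponent 5), and eliminating [c] gives the
    identity excluded by [extreme_root_not_mean]. *)
Lemma eigenvector_alpha_component N k w Rv :
  (1 <= N)%nat -> (k = 0%nat \/ k = N) -> -1 < alpha_of w < 1 -> f_of w 0 <> 0 ->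
  (exists i, (i <= N)%nat /\ Rv i <> 0) ->
  (forall i, (i <= N)%nat -> matvec N (Amat N w) Rv i = lam N k w * Rv i) ->
  Rv 1%nat <> 0.
Proof.
  intros HN Hk Ha Hf (i0 & Hi0 & HR0) HR HR1.
  destruct (lam_extreme N k w HN Hk Ha Hf) as (Hroot & Hext).
  assert (HD := Dt_invertible N w HN Ha Hf).
  destruct (Mt_eigenvector_form N w (matvec N (Dt N w) Rv) (lam N k w) Ha) as (_ & c & Hc & Hform).
  { destruct (classic (exists i, (i <= N)%nat /\ matvec N (Dt N w) Rv i <> 0)) as [?|Hn];
      [assumption|exfalso].
    apply HR0. apply (proj1 HD Rv); [|exact Hi0]. intros j Hj.
    apply NNPP. intros Hj0. apply Hn. now exists j. }
  { exact (proj1 (conj_eigenvector N (Dt N w) (Mt N w) Rv _ HD) HR). }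
  assert (H0 := Hform 0%nat ltac:(lia)). assert (H1 := Hform 1%nat HN).
  rewrite Dt_row0 in H0 by assumption. rewrite Dt_row1 in H1 by assumption.
  rewrite HR1, phi_0 in H0 by assumption. rewrite HR1 in H1.
  apply (extreme_root_not_mean 5 _ (S N) _ (lam N k w) (ext_sign k) Ha
    (phi_Orth 5 _ (S N) Ha) ltac:(lia) Hroot (ext_sign_sqr k) Hext).
  set (a := alpha_of w) in *. set (z := lam N k w) in *.
  rewrite (Orth_unique 5 a 1 _ _ Ha (phi_Orth 5 a 1 Ha) (Orth_1 5 a Ha)) in H1.
  assert (HK1 : Kint 5 a 1 1
    = L 5 a (fun x => x * x) - L 5 a (fun x => x) / L 5 a (fun _ => 1) * L 5 a (fun x => x)).
  { rewrite Kint_L by assumption.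
    rewrite (L_ext 5 a _ (fun x => x * x - L 5 a (fun x => x) / L 5 a (fun _ => 1) * x)).
    - rewrite L_minus, L_scal; try assumption; try polyt. reflexivity.
    - intros x _. rewrite (Orth_unique 5 a 1 _ _ Ha (phi_Orth 5 a 1 Ha) (Orth_1 5 a Ha)).
      simpl. ring. }
  assert (HK0 := Kint_pos 5 a 0 Ha).
  unfold beta in H0. rewrite Kint_4_00 in H0 by assumption.
  rewrite Kint_00 in * by assumption. rewrite HK1 in H1.
  rewrite (L_ext 5 a _ (fun x => x - z * 1 + (a * (x * x) - (z * a) * x))) by (intros; ring).
  rewrite L_plus, !L_minus, !L_scal; try assumption; try polyt.
  set (m0 := L 5 a (fun _ => 1)) in *. set (m1 := L 5 a (fun x => x)) in *.
  set (m2 := L 5 a (fun x => x * x)) in *.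
  set (r := Rv 0%nat) in *.
  (* [Kint 5 a 0 0 * beta_0] is [Kint 4 a 0 0], that is [m0 + a * m1]; as [c] is nonzero, so is
     [r]. *)
  assert (H0' : (m0 + a * m1) * r = c).
  { rewrite <- (Rmult_1_r c), <- H0. field. lra. }
  assert (Hr : r <> 0) by (intros Hr; rewrite Hr in H0'; lra).
  apply Rmult_eq_reg_l with r; [|exact Hr].
  rewrite <- H0' in H1.
  (* The terms in [m1 * m1 / m0] cancel, and the left side is [r] times the integral. *)
  assert (H2 : (m2 - m1 / m0 * m1) * (a * r) - (m0 + a * m1) * r * (z - m1 / m0) = 0)
    by (rewrite <- H1; ring).
  rewrite Rmult_0_r, <- H2. field. lra.
Qed.

Theorem theorem2 (N : nat) (HN : (1 <= N)%nat) (k : nat)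
  (Hk : k = 0%nat \/ k = N)
  (w : nat -> R) (Ha : -1 < w 1%nat < 1) (Hf0 : w 0%nat <> 0)
  (Rv : nat -> R) (HRnz : exists i, (i <= N)%nat /\ Rv i <> 0)
  (HR : forall i, (i <= N)%nat -> matvec N (Amat N w) Rv i = lam N k w * Rv i) :
  exists g : nat -> R,
    (forall j, (j <= N)%nat ->
       derivable_pt_lim (fun t => lam N k (vupd w j t)) (w j) (g j)) /\
    sum_f_R0 (fun j => g j * Rv j) N <> 0.
Proof.
  (* [F] has differentiable coefficients and agrees with [phi] for parameters in (-1,1). *)
  destruct (Orth_family 5 (S N)) as (F & dF & HF & HO).
  assert (HFphi : forall b x, -1 < b < 1 -> F b x = phi 5 b (S N) x).
  { intros b x Hb. apply (Orth_unique 5 b (S N)); [assumption|now apply HO|now apply phi_Orth]. }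
  assert (Hlm : forall b, -1 < b < 1 ->
    F b (lam N k (vupd w 1 b)) = 0 /\
    forall y, F b y = 0 -> ext_sign k * y <= ext_sign k * lam N k (vupd w 1 b)).
  { intros b Hb. destruct (lam_extreme N k (vupd w 1 b) HN Hk Hb Hf0) as (H1 & H2).
    split; [now rewrite HFphi|]. intros y Hy. apply H2. rewrite <- Hy. symmetry. now apply HFphi. }
  destruct (extreme_root_derive 5 N F dF (ext_sign k) (fun b => lam N k (vupd w 1 b)) (w 1%nat)
    ltac:(lia) Ha HF HO (ext_sign_sqr k) Hlm) as (d & Hd & Hder).
  exists (fun j => d * kron 1 j). split.
  - intros j Hj. apply is_derive_Reals. destruct (Nat.eq_dec j 1) as [->|Hne].
    + unfold kron. simpl. rewrite Rmult_1_r. exact Hder.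
    + replace (d * kron 1 j) with 0
        by (unfold kron; destruct (Nat.eqb_spec 1 j); [lia|ring]).
      apply is_derive_ext_loc with (fun _ => lam N k w).
      2:{ apply (is_derive_const (K := R_AbsRing) (V := R_NormedModule)). }
      (* [lam_alpha] needs [f_0] to stay nonzero along the perturbation: for [j = 0] this holds for
         [t] near [w 0], and for other [j] the entry [f_0] is untouched. *)
      assert (Hnz : locally (w j) (fun t => j = 0%nat -> t <> 0)).
      { destruct j as [|j].
        - exists (mkposreal _ (Rabs_pos_lt _ Hf0)). intros t Ht _ ->.
          change (Rabs (0 - w 0%nat) < Rabs (w 0%nat)) in Ht.
          rewrite Rminus_0_l, Rabs_Ropp in Ht. lra.
        - apply filter_forall. intros t Hz. lia. }
      revert Hnz. apply filter_imp. intros t Ht. symmetry.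
      apply lam_alpha; try assumption.
      * unfold f_of, vupd. simpl. destruct j as [|j]; [now apply Ht|exact Hf0].
      * unfold alpha_of, vupd. destruct (Nat.eqb_spec 1 j); [lia|reflexivity].
  - rewrite (sum_eq _ (fun j => kron 1 j * Rv j * d)) by (intros; ring).
    rewrite <- scal_sum, sum_kron by assumption.
    apply Rmult_integral_contrapositive_currified; [exact Hd|].
    exact (eigenvector_alpha_component N k w Rv HN Hk Ha Hf0 HRnz HR).
Qed.
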